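(* For any $k\geq 1$ and $c\in\{0,1,\ldots,k\}$, the graph $Q_{2k+1,[k-c,k+1+c]}$ has a cycle that visits at least a $(1-\epsilon)$-fraction of all vertices of this graph, where $$\epsilon:=\frac{1}{2(c+1)}\min\Big(1,\exp\Big(\frac{(c+1)^2}{k-c}\Big)-1\Big)$$ (for $c=k$ the minimum is understood to be $1$). In particular, for any $c=c(k)\in\{0,1,\ldots,k\}$ and $k\rightarrow\infty$, the cycle visits a $(1-o(1))$-fraction of all vertices.
   Context: The cube $Q_n$ is the graph whose vertices are all bitstrings of length $n$, with an edge between any two bitstrings that differ in exactly one bit. The weight of a bitstring is its number of 1s; the $i$-th level of $Q_n$ is the set of vertices of weight $i$. For integers $0\leq i\leq j\leq n$, $Q_{n,[i,j]}$ denotes the subgraph of $Q_n$ induced by all levels $i,i+1,\ldots,j$. *)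

(* Defs.v *)
From HB Require Import structures.
From mathcomp Require Import all_boot all_order all_algebra.
From mathcomp Require Import all_classical all_reals all_analysis.

Set Implicit Arguments.
Unset Strict Implicit.
Unset Printing Implicit Defensive.

Import Order.TTheory GRing.Theory Num.Theory.
Import numFieldNormedType.Exports.

Local Open Scope ring_scope.

Definition bitstring (n : nat) : finType := n.-tuple bool.

Definition weight (n : nat) (x : bitstring n) : nat := count_mem true x.

Definition cube_adj (n : nat) : rel (bitstring n) :=
  fun x y => #|[pred i : 'I_n | tnth x i != tnth y i]| == 1%N.

Definition levels (n i j : nat) : {set bitstring n} :=
  [set x : bitstring n | (i <= weight x <= j)%N].

(* A cycle of the subgraph of (T, e) induced by A, listed as the sequence of
   its pairwise distinct vertices. Without the bound on the size, [ucycle]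
   would also accept the empty sequence and a single edge. *)
Definition is_induced_cycle (T : finType) (e : rel T) (A : {set T})
    (s : seq T) : Prop :=
  [/\ (3 <= size s)%N, ucycle e s & {subset s <= A}].

Definition is_cube_cycle (n i j : nat) (s : seq (bitstring n)) : Prop :=
  is_induced_cycle (@cube_adj n) (levels n i j) s.

(* For c = k the exponent would divide by 0 (which is 0 in MathComp), so the
   convention that the minimum is then 1 has to be spelled out. *)
Definition eps (R : realType) (k c : nat) : R :=
  ((2 * c.+1)%N%:R)^-1 *
  (if c == k then 1
   else Num.min 1 (expR ((c.+1)%:R ^+ 2 / (k - c)%N%:R) - 1)).

(* Main.v *)
Require Import Defs.
From HB Require Import structures.
From mathcomp Require Import all_boot all_order all_algebra.
From mathcomp Require Import zify ring lra.
From mathcomp Require Import all_classical all_reals all_analysis.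

Set Implicit Arguments.
Unset Strict Implicit.
Unset Printing Implicit Defensive.

Import Order.TTheory GRing.Theory Num.Theory.
Import numFieldNormedType.Exports.

(** Three kinds of cycles are used. For c = 0 the middle levels of Q_(2k+1) have a Hamilton
    cycle: ordered trees with k edges give a 2-factor, and its cycles are joined along
    6-cycles that pull a leaf towards the root, so that all of them get attached to the cycle
    of the star. An induction on n, joining cycles of the two subcubes, then yields for every
    i < n a cycle of Q_n in the levels i and i+1 that visits all vertices of the smaller level.

    If exp((c+1)^2/(k-c)) < 2, such cycles for the c+1 disjoint pairs of consecutive levels
    are joined, at the cost of two vertices per joint. The missing vertices are counted by
    differences of consecutive binomial coefficients near the middle, and the slack between
    (c+1)^2/(k-c) and (c+1)^2/(k+2) absorbs the 2c vertices lost at the joints.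

    Otherwise it is enough to miss at most an average level. Here Q_(2k+1) is the product of a
    4-cycle with Q_(2k-1): the 4-cycles over a Hamilton path of the middle levels of Q_(2k-1)
    are joined in a row, and the 4-cycles over the outer levels are attached to them in columns
    along matchings between consecutive levels, as in a comb. On the outermost level only an
    edge of each 4-cycle is attached, so 2 binomial(2k, k+c+1) vertices are missed. *)

(** * Cycles as lists, and detours *)

(** A cycle grows either by replacing one of its edges by a path or by deleting a vertex and linking
    the open ends, so each construction has to record which edges are still free for the next one;
    this dictates the invariants.

    Two cycles that are to be joined need not lie next to each other. The way out is that each may
    be replaced by its image under a permutation of the coordinates. Up to such a permutation a pair
    of vertices is determined by its two weights and its distance, and two distinct neighbours of a
    vertex always have distance 2. Hence an opened cycle can be moved so that its ends become any
    prescribed pair of vertices of the right weight at distance 2.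

    The threshold between the two constructions is natural: with x = (c+1)^2/(k-c), exp(x) < 2
    forces x <= 1, and this is the range in which a loss of x binomial(2k+1, k) vertices stays below
    eps times the total. *)

Definition steps (T : Type) (x : T) (p : seq T) : seq (T * T) := pairmap pair x p.

Definition csteps (T : Type) (s : seq T) : seq (T * T) :=
  if s is x :: p then steps x (rcons p x) else [::].

Definition same_edge (T : eqType) (a b u v : T) : bool :=
  ((a == u) && (b == v)) || ((a == v) && (b == u)).

Definition cedge (T : eqType) (s : seq T) (a b : T) : bool :=
  ((a, b) \in csteps s) || ((b, a) \in csteps s).

Lemma path_steps (T : Type) (e : rel T) x p :
  path e x p = all (fun q => e q.1 q.2) (steps x p).
Proof. by elim: p x => //= y p IH x; rewrite IH. Qed.

Lemma cycle_csteps (T : Type) (e : rel T) s :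
  cycle e s = all (fun q => e q.1 q.2) (csteps s).
Proof. by case: s => //= x p; rewrite path_steps. Qed.

Lemma steps_cat (T : Type) (x : T) p q :
  steps x (p ++ q) = steps x p ++ steps (last x p) q.
Proof. exact: pairmap_cat. Qed.

Lemma steps_rcons (T : Type) (x : T) p y :
  steps x (rcons p y) = rcons (steps x p) (last x p, y).
Proof. by rewrite -cats1 steps_cat cats1. Qed.

Lemma csteps_cat (T : Type) (x y : T) p q :
  csteps ((x :: p) ++ y :: q) = steps x (rcons p y) ++ steps y (rcons q x).
Proof. by rewrite /= rcons_cat rcons_cons -cat_rcons steps_cat last_rcons. Qed.

Lemma csteps_catC (T : eqType) (s t : seq T) :
  perm_eq (csteps (s ++ t)) (csteps (t ++ s)).
Proof.
case: s => [|x p]; first by rewrite cats0.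
case: t => [|y q]; first by rewrite cats0.
by rewrite !csteps_cat perm_catC.
Qed.

Definition swap (T : Type) (q : T * T) : T * T := (q.2, q.1).

Lemma steps_rev (T : Type) (x : T) p :
  steps (last x p) (rev (belast x p)) = rev (map (@swap T) (steps x p)).
Proof.
elim: p x => //= y p IH x.
rewrite rev_cons steps_rcons IH rev_cons; congr (rcons _ (_, _)).
by case: p {IH} => //= z p; rewrite rev_cons last_rcons.
Qed.

Lemma csteps_rev (T : eqType) (s : seq T) :
  perm_eq (csteps (rev s)) (map (@swap T) (csteps s)).
Proof.
case: s => // x p; rewrite rev_cons -cats1 (perm_trans (csteps_catC _ _)) //=.
have := steps_rev x (rcons p x); rewrite last_rcons belast_rcons rev_cons => ->.
by rewrite perm_rev.
Qed.

Lemma cedgeC (T : eqType) (s : seq T) a b : cedge s a b = cedge s b a.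
Proof. by rewrite /cedge orbC. Qed.

Lemma cedge_catC (T : eqType) (s t : seq T) : cedge (s ++ t) =2 cedge (t ++ s).
Proof. by move=> a b; rewrite /cedge !(perm_mem (csteps_catC s t)). Qed.

Lemma cedge_rot (T : eqType) n (s : seq T) : cedge (rot n s) =2 cedge s.
Proof. by move=> a b; rewrite /rot cedge_catC cat_take_drop. Qed.

Lemma mem_swap (T : eqType) (s : seq (T * T)) a b :
  ((a, b) \in map (@swap T) s) = ((b, a) \in s).
Proof.
have inj : injective (@swap T) by move=> [? ?] [? ?] [-> ->].
by rewrite -(mem_map inj s (b, a)).
Qed.

Lemma cedge_rev (T : eqType) (s : seq T) : cedge (rev s) =2 cedge s.
Proof.
by move=> a b; rewrite /cedge !(perm_mem (csteps_rev s)) !mem_swap orbC.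
Qed.

Lemma mem_stepsP (T : eqType) (x : T) p u v : (u, v) \in steps x p ->
  exists p1 p2, p = p1 ++ v :: p2 /\ last x p1 = u.
Proof.
elim: p x => //= y p IH x; rewrite inE => /orP[/eqP[-> ->]|/IH[p1 [p2 [-> <-]]]].
  by exists [::], p.
by exists (y :: p1), p2.
Qed.

Lemma cycle_rev (T : Type) (e : rel T) (s : seq T) :
  symmetric e -> cycle e (rev s) = cycle e s.
Proof. by move=> sym; rewrite rev_cycle; apply: eq_cycle => x y; rewrite sym. Qed.

(* Turns a cycle so that the given edge closes it up. *)
Lemma cedge_open (T : eqType) (e : rel T) (s : seq T) u v :
  symmetric e -> cycle e s -> cedge s u v ->
  exists p, [/\ perm_eq (v :: p) s, cycle e (v :: p), last v p = u
              & cedge (v :: p) =2 cedge s].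
Proof.
move=> sym.
have open w z (t : seq T) : cycle e t -> (w, z) \in csteps t ->
  exists p, [/\ perm_eq (z :: p) t, cycle e (z :: p), last z p = w
              & cedge (z :: p) =2 cedge t].
  case: t => // x p cyc /mem_stepsP[p1 [p2 [def_p last_p1]]].
  case/lastP: p2 def_p => [|p2 y] def_p.
    move: def_p; rewrite cats1 => /rcons_inj[def_p def_x].
    by exists p1; rewrite -def_x -last_p1 -def_p; split.
  move: def_p cyc; rewrite -rcons_cons -rcons_cat => /rcons_inj[-> _] cyc.
  exists (p2 ++ x :: p1); rewrite -cat_cons; split.
  - by rewrite perm_catC.
  - by move: cyc; rewrite -cat_cons -(rot_cycle (size (x :: p1))) rot_size_cat.
  - by rewrite last_cat.
  - exact: cedge_catC.
move=> cyc /orP[uv|vu]; first exact: open.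
have [||p [perm cyc' lastp ce]] := open u v (rev s).
- by rewrite cycle_rev.
- by rewrite (perm_mem (csteps_rev s)) mem_swap.
exists p; split=> //; first by rewrite (perm_trans perm) ?perm_rev.
by move=> a b; rewrite ce cedge_rev.
Qed.

(** Turned so that the step from [u] to [v] closes it up, the cycle stays a cycle when [p] is
    appended. The last two clauses tell which edges remain available for later detours. *)
Lemma attach (T : eqType) (e : rel T) (s : seq T) u p v :
  symmetric e -> ucycle e s -> cedge s u v ->
  path e u (rcons p v) -> uniq p -> ~~ has [in s] p -> 
  exists s', [/\ ucycle e s', perm_eq s' (s ++ p),
    forall a b, cedge s a b -> ~~ same_edge a b u v -> cedge s' a b
    & forall a b, (a, b) \in steps u (rcons p v) -> cedge s' a b].
Proof.
move=> sym /andP[cyc us] uv ep up dis.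
have [q [perm cycq lastq ce]] := cedge_open sym cyc uv.
have perm' : perm_eq ((v :: q) ++ p) (s ++ p) by rewrite perm_cat2r.
have csE : csteps ((v :: q) ++ p) = steps v q ++ steps u (rcons p v).
  by rewrite /= rcons_cat steps_cat lastq.
exists ((v :: q) ++ p); split=> //.
- rewrite /ucycle (perm_uniq perm') cat_uniq us dis up !andbT.
  move: cycq ep; rewrite !cycle_csteps csE path_steps all_cat => + ->.
  by rewrite /= steps_rcons all_rcons => /andP[_ ->].
- move=> a b; rewrite -ce /cedge csE /csteps steps_rcons !mem_rcons !inE lastq.
  rewrite /same_edge !mem_cat !xpair_eqE.
  case/orP => /orP[/andP[/eqP-> /eqP->]|->]; rewrite ?eqxx ?orbT //.
- by move=> a b ab; rewrite /cedge csE mem_cat ab orbT.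
Qed.

Lemma cedge_mem (T : eqType) (s : seq T) a b : cedge s a b -> (a \in s) && (b \in s).
Proof.
have mem u v : (u, v) \in csteps s -> (u \in s) && (v \in s).
  case: s => // x p /mem_stepsP[p1 [p2 [def_p <-]]].
  have sub w : w \in rcons p x -> w \in x :: p by rewrite mem_rcons.
  apply/andP; split; last by apply: sub; rewrite def_p mem_cat mem_head orbT.
  case/lastP: p1 def_p => [|p1 w] def_p; first exact: mem_head.
  by apply: sub; rewrite last_rcons def_p mem_cat mem_rcons mem_head.
by case/orP => /mem // /andP[-> ->].
Qed.

Lemma mem_steps_inner (T : eqType) (u v : T) p a b : p != [::] ->
  (a, b) \in steps u (rcons p v) -> (a \in p) || (b \in p).
Proof.
move=> p_n0 /mem_stepsP[p1 [p2 []]].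
case/lastP: p2 => [|p2 w].
  rewrite cats1 => /rcons_inj[<- _] <-.
  by case: p p_n0 => // w p _ /=; rewrite mem_last.
by rewrite -rcons_cons -rcons_cat => /rcons_inj[-> _] _;
  rewrite !mem_cat mem_head !orbT.
Qed.

(** The replaced edges are distinct, so the detours can be made one by one. An edge of a detour has
    an endpoint off [s], because [p i] is nonempty; later detours replace edges of [s] and cannot
    destroy it. *)
Lemma attach_many (I T : eqType) (e : rel T) (r : seq I) (u v : I -> T)
    (p : I -> seq T) (s : seq T) :
  symmetric e -> ucycle e s -> uniq r ->
  {in r, forall i, cedge s (u i) (v i)} ->
  {in r, forall i, (p i != [::]) && path e (u i) (rcons (p i) (v i))} ->
  uniq (flatten (map p r)) -> ~~ has [in s] (flatten (map p r)) ->
  {in r &, forall i j, same_edge (u i) (v i) (u j) (v j) -> i = j} ->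
  exists s', [/\ ucycle e s', perm_eq s' (s ++ flatten (map p r)),
    forall a b, cedge s a b -> {in r, forall i, ~~ same_edge a b (u i) (v i)} ->
      cedge s' a b
    & {in r, forall i a b, (a, b) \in steps (u i) (rcons (p i) (v i)) ->
       cedge s' a b}].
Proof.
move=> sym; elim: r s => [|i r IH] s cyc /=.
  by exists s; split=> //; rewrite ?cats0.
move=> /andP[i_r ur] uv ep; rewrite cat_uniq has_cat negb_or.
move=> /and3P[upi dispr upr] /andP[dispi dispr'] inj.
have ri : i \in i :: r by exact: mem_head.
have rj j : j \in r -> j \in i :: r by move=> jr; rewrite inE jr orbT.
have /andP[pi0 epi] := ep _ ri.
have [s1 [cyc1 perm1 keep1 new1]] := attach sym cyc (uv _ ri) epi upi dispi.
have nsame j : j \in r -> ~~ same_edge (u j) (v j) (u i) (v i).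
  by move=> jr; apply: contra i_r => /(inj _ _ (rj _ jr) ri) <-.
have [|||||s2 [cyc2 perm2 keep2 new2]] := IH s1 cyc1 ur.
- by move=> j jr; apply: keep1 (nsame _ jr); exact/uv/rj.
- by move=> j jr; exact/ep/rj.
- by [].
- apply/hasPn => x xr; rewrite /= (perm_mem perm1) mem_cat negb_or.
  by rewrite (hasPn dispr' x xr); apply: contra dispr => xi; apply/hasP; exists x.
- by move=> j k jr kr; apply: inj; exact: rj.
exists s2; split=> //.
- by rewrite (perm_trans perm2) // catA perm_cat2r.
- move=> a b ab nab; apply: keep2 => [|j jr]; last exact/nab/rj.
  by apply: keep1 => //; exact: nab.
- move=> j; rewrite inE => /orP[/eqP->|jr a b]; last exact: new2.
  move=> a b ab; apply: keep2 => [|k kr]; first exact: new1.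
  have /andP[us vs] := cedge_mem (uv _ (rj _ kr)).
  have nin x : x \in p i -> x \notin s by exact: (hasPn dispi x).
  apply/negP => /orP[] /andP[/eqP au /eqP bv]; subst a b.
    by case/orP: (mem_steps_inner pi0 ab) => /nin; rewrite ?us ?vs.
  by case/orP: (mem_steps_inner pi0 ab) => /nin; rewrite ?us ?vs.
Qed.

(** * The cube on Boolean lists *)

(** Lists instead of tuples make induction on the first bit painless. [zip] drops the surplus of the
    longer list, hence the comparison of sizes in [adj]. *)
Definition dist (x y : seq bool) : nat := count (fun q => q.1 != q.2) (zip x y).

Arguments dist : simpl never.

Definition adj (x y : seq bool) : bool := (size x == size y) && (dist x y == 1).

Definition wt (x : seq bool) : nat := count_mem true x.

Arguments wt : simpl never.

Lemma wt_cons b x : wt (b :: x) = b + wt x.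
Proof. by case: b. Qed.

Lemma wt_cat x y : wt (x ++ y) = wt x + wt y.
Proof. exact: count_cat. Qed.

Lemma dist_cons a b x y : dist (a :: x) (b :: y) = (a != b) + dist x y.
Proof. by []. Qed.

Lemma distC x y : dist x y = dist y x.
Proof. by elim: x y => [|a x IH] [|b y] //; rewrite !dist_cons IH eq_sym. Qed.

Lemma dist_eq0 x y : size x = size y -> (dist x y == 0) = (x == y).
Proof.
elim: x y => [|a x IH] [|b y] //= [sz].
by rewrite dist_cons addn_eq0 eqb0 negbK IH.
Qed.

Lemma distxx x : dist x x = 0.
Proof. by apply/eqP; rewrite dist_eq0. Qed.

Lemma adj_sym : symmetric adj.
Proof. by move=> x y; rewrite /adj distC eq_sym. Qed.

Lemma adj_size x y : adj x y -> size x = size y.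
Proof. by case/andP => /eqP. Qed.

Lemma adj_cons a x y : adj (a :: x) (a :: y) = adj x y.
Proof. by rewrite /adj /= dist_cons eqxx. Qed.

Lemma adj_cat p x y : adj (p ++ x) (p ++ y) = adj x y.
Proof. by elim: p => //= a p IH; rewrite adj_cons. Qed.

Lemma adj_head a b x : adj (a :: x) (b :: x) = (a != b).
Proof. by rewrite /adj /= eqxx dist_cons distxx addn0 eqb1. Qed.

Lemma dist_negb x y : dist (map negb x) (map negb y) = dist x y.
Proof.
elim: x y => [|a x IH] [|b y] //=; rewrite !dist_cons IH.
by rewrite (inj_eq negb_inj).
Qed.

Lemma adj_negb x y : adj (map negb x) (map negb y) = adj x y.
Proof. by rewrite /adj !size_map dist_negb. Qed.

Lemma wt_negb x : wt (map negb x) = size x - wt x.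
Proof.
have : wt x + wt (map negb x) = size x.
  by elim: x => // a x IH /=; rewrite !wt_cons -IH; case: a => /=; lia.
lia.
Qed.

Lemma wt_size x : wt x <= size x. Proof. exact: count_size. Qed.

Lemma adj_wt x y : adj x y -> (wt x == (wt y).+1) || (wt y == (wt x).+1).
Proof.
elim: x y => [|a x IH] [|b y] // /[dup] /adj_size [sz].
have [<-|ab] := eqVneq a b.
  by rewrite adj_cons !wt_cons => /IH; case: a => /=; lia.
rewrite /adj /= dist_cons ab sz eqxx /= eqSS dist_eq0 // => /eqP->.
by rewrite !wt_cons; case: a b ab => [] [] //=; lia.
Qed.

Lemma dist_common w x y : adj w x -> adj w y -> x != y -> dist x y = 2.
Proof.
move=> /[dup] /adj_size swx /andP[_ /eqP dwx] /[dup] /adj_size swy /andP[_ /eqP dwy].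
rewrite -dist_eq0 -?swx //.
elim: w x y swx swy dwx dwy => [|a w IH] [|b x] [|c y] //= [swx] [swy].
case: a b c => [] [] []; rewrite !dist_cons /= ?add0n; try exact: IH;
  move=> /eqP + /eqP; rewrite ?add1n ?eqSS ?dist_eq0 -?swx ?swy //;
  first [by move=> dwx /eqP<- _; rewrite distC (eqP dwx)
        |by move=> /eqP<- /eqP->
        |by move=> /eqP<- /eqP<-; rewrite eqxx].
Qed.

(* A permutation of the coordinates when Is is a permutation of iota 0 n. *)
Definition act (Is : seq nat) (x : seq bool) : seq bool := map (nth false x) Is.

Lemma act_zip n Is x y : size x = n -> size y = n -> perm_eq Is (iota 0 n) ->
  perm_eq (zip (act Is x) (act Is y)) (zip x y).
Proof.
move=> sx sy pI; rewrite zip_map.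
rewrite -[X in perm_eq _ X](mkseq_nth (false, false)) size_zip sx sy minnn.
rewrite (@eq_map _ _ _ (nth (false, false) (zip x y))) ?perm_map // => i.
by rewrite nth_zip ?sx.
Qed.

Lemma act_dist n Is x y : size x = n -> size y = n -> perm_eq Is (iota 0 n) ->
  dist (act Is x) (act Is y) = dist x y.
Proof. by move=> sx sy pI; have /permP := act_zip sx sy pI; apply. Qed.

Lemma act_size n Is x : perm_eq Is (iota 0 n) -> size (act Is x) = n.
Proof. by move=> pI; rewrite size_map (perm_size pI) size_iota. Qed.

Lemma act_wt n Is x : size x = n -> perm_eq Is (iota 0 n) -> wt (act Is x) = wt x.
Proof.
move=> sx pI; suff /permP : perm_eq (act Is x) x by apply.
by rewrite -[X in perm_eq _ X](mkseq_nth false x) sx perm_map.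
Qed.

Lemma act_adj n Is x y : size x = n -> size y = n -> perm_eq Is (iota 0 n) ->
  adj (act Is x) (act Is y) = adj x y.
Proof.
by move=> sx sy pI; rewrite /adj (act_dist sx sy pI) !(act_size _ pI) sx sy.
Qed.

Lemma act_inj n Is : perm_eq Is (iota 0 n) ->
  {in [pred x | size x == n] &, injective (act Is)}.
Proof.
move=> pI x y /eqP sx /eqP sy eq_act; apply/eqP.
by rewrite -dist_eq0 ?sx ?sy // -(act_dist sx sy pI) eq_act distxx.
Qed.

Lemma zip_counts x y (P : pred (bool * bool)) : size x = size y ->
  let N b c := count_mem (b, c) (zip x y) in
  [/\ count P (zip x y) = P (true, true) * N true true + P (true, false) * N true false
        + P (false, true) * N false true + P (false, false) * N false false,
      wt x = N true true + N true false, wt y = N true true + N false true,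
      dist x y = N true false + N false true
    & size x = N true true + N true false + N false true + N false false].
Proof.
elim: x y => [|a x IH] [|b y] //; first by move=> _; split; rewrite ?muln0.
move=> [sz]; have [cP cx cy cd cs] := IH y sz.
rewrite /= !wt_cons dist_cons cP cx cy cd cs.
by case: a b => [] []; rewrite /= ?mulnDr ?muln1; split; lia.
Qed.

(** Weights, distance and length determine how often each of the four pairs of bits occurs in
    [zip x y], so the two zipped lists are permutations of each other. *)
Lemma act_transitive n x y x' y' :
  size x = n -> size y = n -> size x' = n -> size y' = n ->
  wt x = wt x' -> wt y = wt y' -> dist x y = dist x' y' ->
  exists Is, [/\ perm_eq Is (iota 0 n), act Is x = x' & act Is y = y'].
Proof.
move=> sx sy sx' sy' wx wy dxy.
have : perm_eq (zip x' y') (zip x y).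
  apply/permP => P.
  have [|-> wx1 wy1 d1 s1] := zip_counts P (_ : size x = size y); first by rewrite sy.
  have [|-> wx2 wy2 d2 s2] := zip_counts P (_ : size x' = size y'); first by rewrite sy'.
  rewrite sx' -sx s1 -wx wx1 -wy wy1 -dxy d1 in wx2 wy2 d2 s2.
  move: wx2 wy2 d2 s2; do 8! move: (count_mem _ (zip _ _)) => ?; move=> *.
  by congr (_ * _ + _ * _ + _ * _ + _ * _); lia.
case/(perm_iotaP (false, false)) => Is; rewrite size_zip sx sy minnn => pI eq_zip.
exists Is; split=> //.
  rewrite -(unzip1_zip (s := x') (t := y')) ?sx' ?sy' // eq_zip.
  by rewrite unzip1_map_nth_zip ?sx ?sy.
rewrite -(unzip2_zip (s := x') (t := y')) ?sx' ?sy' // eq_zip.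
by rewrite unzip2_map_nth_zip ?sx ?sy.
Qed.

(** Setting a bit that is zero in both strings does not affect the positions where they differ. *)
Lemma common_raise x y : size x = size y -> (false, false) \in zip x y ->
  exists x' y', [/\ adj x x', adj y y', wt x' = (wt x).+1, wt y' = (wt y).+1
                  & dist x' y' = dist x y].
Proof.
elim: x y => [|a x IH] [|b y] // [sz]; rewrite /= inE => /orP[/eqP[<- <-]|].
  exists (true :: x), (true :: y).
  by rewrite !adj_head !wt_cons !dist_cons !add0n.
move=> /(IH _ sz)[x' [y' [ax ay wx wy d]]].
exists (a :: x'), (b :: y').
by rewrite !adj_cons !wt_cons !dist_cons wx wy d !addnS.
Qed.

Fixpoint lev (n i : nat) : seq (seq bool) :=
  match n, i with
  | 0, 0 => [:: [::]]
  | 0, _.+1 => [::]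
  | n'.+1, 0 => map (cons false) (lev n' 0)
  | n'.+1, i'.+1 => map (cons false) (lev n' i) ++ map (cons true) (lev n' i')
  end.

Lemma mem_map_cons (a b : bool) (x : seq bool) s :
  (a :: x \in map (cons b) s) = (a == b) && (x \in s).
Proof.
apply/mapP/andP => [[y ys [-> ->]]|[/eqP-> xs]]; first by rewrite eqxx.
by exists x.
Qed.

Lemma mem_lev n i x : (x \in lev n i) = (size x == n) && (wt x == i).
Proof.
elim: n i x => [|n IH] [|i] [|a x] //=; rewrite ?mem_cat ?eqSS ?wt_cons.
- by apply/mapP => -[].
- by rewrite mem_map_cons IH; case: a; rewrite ?andbF.
- by apply/orP => -[] /mapP[].
- by rewrite !mem_map_cons !IH; case: a; rewrite /= ?orbF ?eqSS.
Qed.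

Lemma lev_uniq n i : uniq (lev n i).
Proof.
elim: n i => [|n IH] [|i] //=; rewrite ?cat_uniq !map_inj_uniq ?IH ?andbT //;
  try by move=> x y [].
by apply/hasPn => _ /mapP[x _ ->]; rewrite /= mem_map_cons.
Qed.

Lemma size_lev n i : size (lev n i) = 'C(n, i).
Proof.
elim: n i => [|n IH] [|i] //=; rewrite ?size_cat !size_map !IH ?bin0 ?binS //.
Qed.

(** * The middle levels *)

(* Ordered rooted trees: Node u v has a first child carrying the subtree u, and v is the
   rest of the tree. *)
Inductive tree := Leaf | Node of tree & tree.

(** The Dyck word of the walk around the tree: [true] goes down an edge, [false] back up. *)
Fixpoint word (t : tree) : seq bool :=
  if t is Node u v then true :: word u ++ false :: word v else [::].

Fixpoint tsize (t : tree) : nat :=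
  if t is Node u v then (tsize u + tsize v).+1 else 0.

Fixpoint app (t r : tree) : tree :=
  if t is Node u v then Node u (app v r) else r.

(* Moves the root of the ordered tree to its first child. *)
Definition rho (t : tree) : tree :=
  if t is Node u v then app u (Node v Leaf) else Leaf.

(** Summed over the edges of the ordered tree, the number of edges below. It serves as the measure
    that pulling a leaf decreases. *)
Fixpoint area (t : tree) : nat :=
  if t is Node u v then area u + area v + tsize u else 0.

Lemma appA t u v : app (app t u) v = app t (app u v).
Proof. by elim: t => //= a _ b ->. Qed.

Lemma app_leaf t : app t Leaf = t.
Proof. by elim: t => //= a _ b ->. Qed.

Lemma tsize_app t u : tsize (app t u) = tsize t + tsize u.
Proof. by elim: t => //= a _ b ->; rewrite addnA. Qed.

Lemma word_app t u : word (app t u) = word t ++ word u.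
Proof. by elim: t => //= a _ b ->; rewrite -catA. Qed.

Lemma size_word t : size (word t) = (tsize t).*2.
Proof. by elim: t => //= u IHu v IHv; rewrite size_cat /= IHu IHv; lia. Qed.

Lemma wt_word t : wt (word t) = tsize t.
Proof. by elim: t => //= u IHu v IHv; rewrite wt_cons wt_cat wt_cons IHu IHv; lia. Qed.

Lemma tsize_rho t : tsize (rho t) = tsize t.
Proof. by case: t => // u v; rewrite tsize_app /= addn0 addnS. Qed.

(** Each rotation moves the root along one side of an edge; once both sides of all edges of [t] are
    passed, [t] stands behind [r]. *)
Lemma iter_rho_app t r : iter (tsize t).*2 rho (app t r) = app r t.
Proof.
elim: t r => [|u IHu v IHv] r; first by rewrite app_leaf.
have -> : (tsize (Node u v)).*2 = (tsize v).*2 + (1 + ((tsize u).*2 + 1)).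
  by rewrite /=; lia.
by rewrite !iterD /= IHu /= !appA IHv !appA.
Qed.

Lemma iter_rho t : iter (tsize t).*2 rho t = t.
Proof. by rewrite -{2}(app_leaf t) iter_rho_app. Qed.

Lemma tsize_iter_rho j t : tsize (iter j rho t) = tsize t.
Proof. by elim: j => //= j IH; rewrite tsize_rho. Qed.

Lemma word_prefix t m : size (take m (word t)) <= (wt (take m (word t))).*2.
Proof.
elim: t m => // u IHu v IHv [|m] //=; rewrite take_cat wt_cons.
case: (ltnP m (size (word u))) => _; first by have := IHu m; rewrite /=; lia.
rewrite size_cat wt_cat wt_word size_word.
case: (m - _) => [|m'] //=; first by rewrite addn0; lia.
by rewrite wt_cons; have := IHv m'; lia.
Qed.

Lemma word_cat_inj t t' r r' :
  word t ++ false :: r = word t' ++ false :: r' -> t = t' /\ r = r'.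
Proof.
elim: t t' r r' => [|u IHu v IHv] [|u' v'] r r' //=; first by case.
by rewrite -!catA /= => -[/IHu[-> /IHv[-> ->]]].
Qed.

Lemma word_inj : injective word.
Proof.
move=> t t' eq_tt'; have /(_ _)[|//] := @word_cat_inj t t' [::] [::].
by rewrite eq_tt'.
Qed.

(** The inserted [true, false] is a new leaf, added at the corresponding point of the walk around
    the tree. *)
Lemma word_insert t a b : word t = a ++ b ->
  exists2 t', word t' = a ++ true :: false :: b & tsize t' = (tsize t).+1.
Proof.
elim: t a b => [|u IHu v IHv] a b /=.
  by case: a => [|//]; case: b => // _; exists (Node Leaf Leaf).
case: a => [|c a] /=.
  move=> <-; exists (Node Leaf (Node u v)) => //=.
case=> <-; have [le_au|lt_ua] := leqP (size a) (size (word u)).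
  move=> eq_w; have : word u = a ++ drop (size a) (word u).
    rewrite -[LHS](cat_take_drop (size a)); congr (_ ++ _).
    have := congr1 (take (size a)) eq_w; rewrite (take_size_cat b (erefl _)) take_cat.
    case: ltngtP le_au => // -> _.
    by rewrite subnn take0 cats0 take_oversize // => ->.
  move=> eq_u; have [u' eq_u' sz] := IHu _ _ eq_u.
  exists (Node u' v); rewrite /= ?eq_u' ?sz //.
  move: eq_w; rewrite {1}eq_u -!catA => /eqP.
  by rewrite eqseq_cat // eqxx => /eqP <-.
move=> eq_w.
have eq_a : a = word u ++ false :: drop (size (word u)).+1 a.
  rewrite -[LHS](cat_take_drop (size (word u))).
  have := congr1 (take (size (word u))) eq_w.
  rewrite (take_size_cat _ (erefl _)) take_cat lt_ua => <-.
  rewrite (drop_nth false lt_ua); congr (_ ++ _ :: _).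
  have := congr1 (nth false ^~ (size (word u))) eq_w.
  by rewrite !nth_cat ltnn subnn lt_ua.
move: eq_w; rewrite eq_a -catA /= => /eqP; rewrite eqseq_cat // eqxx => /eqP[].
move=> /IHv[v' eq_v' sz]; exists (Node u v'); rewrite /= ?sz ?addnS //.
by rewrite eq_v' -catA.
Qed.

(** * Cyclic shifts and the cycle lemma *)

Definition shift (s : nat) (x : seq bool) : seq bool := iter s (rotr 1) x.

Lemma shiftS s x : shift s.+1 x = rotr 1 (shift s x).
Proof. by []. Qed.

Lemma shift_add s s' x : shift (s + s') x = shift s (shift s' x).
Proof. exact: iterD. Qed.

Lemma size_shift s x : size (shift s x) = size x.
Proof. by elim: s => //= s IH; rewrite size_rotr. Qed.

Lemma wt_shift s x : wt (shift s x) = wt x.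
Proof.
elim: s => //= s IH; rewrite -[RHS]IH.
by apply/permP; rewrite perm_rot.
Qed.

Lemma shift_rotr s x : s <= size x -> shift s x = rotr s x.
Proof.
elim: s => [|s IH] lt_s; first by rewrite /rotr subn0 rot_size.
have eq_s : rotr s x = rot 1 (rotr s.+1 x).
  by rewrite /rotr -rotS ?subnSK //; exact: leq_subr.
by rewrite shiftS (IH (ltnW lt_s)) eq_s rotK.
Qed.

Lemma shift_size x : shift (size x) x = x.
Proof. by rewrite shift_rotr // /rotr subnn rot0. Qed.

Lemma shift_mod s x : shift (s %% size x) x = shift s x.
Proof.
rewrite [in RHS](divn_eq s (size x)) addnC shift_add; congr shift.
by elim: (s %/ _) => // q IH; rewrite mulSn shift_add -IH shift_size.
Qed.

Lemma shift_inj s : injective (shift s).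
Proof. by elim: s => // s IH x y /rotr_inj /IH. Qed.

Lemma adj_rotr1 x y : size x = size y -> adj (rotr 1 x) (rotr 1 y) = adj x y.
Proof.
case/lastP: x => [|x a]; case/lastP: y => [|y b]; rewrite ?size_rcons // => -[sz].
rewrite !rotr1_rcons /adj /= !size_rcons sz dist_cons; congr (_ && (_ == _)).
rewrite /dist zip_rcons // -cats1 count_cat /= addn0 addnC //.
Qed.

Lemma adj_shift s x y : size x = size y -> adj (shift s x) (shift s y) = adj x y.
Proof. by move=> sz; elim: s => //= s IH; rewrite adj_rotr1 ?size_shift. Qed.

(* The uniqueness half of the cycle lemma. *)
Lemma word_rotr t t' c m : m <= (tsize t).*2 ->
  rcons (word t') c = rotr m (rcons (word t) c) -> m = 0.
Proof.
case: m => // m le_m; set x := rcons (word t) c => eq_r.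
have sx : size x = (tsize t).*2.+1 by rewrite size_rcons size_word.
pose n1 := size x - m.+1; pose P := take n1 x; pose Q := drop n1 x.
have sP : size P = n1 by rewrite size_takel // leq_subr.
have sQ : size Q = m.+1 by rewrite size_drop sx /n1 sx; lia.
have defx : x = P ++ Q by rewrite cat_take_drop.
have {eq_r} defr : rcons (word t') c = Q ++ P by [].
case/lastP: P sP defx defr => [|P p]; first by rewrite /n1 sx /=; lia.
case/lastP: Q sQ => [|Q q] // _ _; rewrite -!rcons_cat => /rcons_inj[defw cq].
move=> /rcons_inj[defw' cp]; subst p q.
(* The two words are [P c Q] and [Q c P], so [P] and [Q], with or without the [c] behind them, are
   prefixes of Dyck words. Their prefix bounds together contradict the balance of [word t]. *)
have pre u L M : word u = rcons L c ++ M ->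
    size L <= (wt L).*2 /\ (size L).+1 <= (wt L + c).*2.
  rewrite -cats1 -catA => eq_u; split.
    by have := word_prefix u (size L); rewrite eq_u take_size_cat.
  have := word_prefix u (size (L ++ [:: c])).
  by rewrite eq_u catA take_size_cat // size_cat wt_cat wt_cons /wt /= addn0 addn1.
have [p1 p2] := pre _ _ _ defw; have [q1 q2] := pre _ _ _ defw'.
have := size_word t; rewrite -wt_word defw wt_cat -cats1 !size_cat wt_cat wt_cons /=.
by rewrite addn0; case: c {pre sx x n1 defw defw'} p1 p2 q1 q2 => /=; lia.
Qed.

Arguments shift : simpl never.

(* For trees with k edges and s modulo 2k+1, these are the strings of length 2k+1 of
   weight k (c = false) or k+1 (c = true), each occurring once. *)
Definition lab (c : bool) (t : tree) (s : nat) : seq bool := shift s (rcons (word t) c).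

Lemma size_lab c t s : size (lab c t s) = (tsize t).*2.+1.
Proof. by rewrite size_shift size_rcons size_word. Qed.

Lemma wt_lab c t s : wt (lab c t s) = tsize t + c.
Proof. by rewrite wt_shift -cats1 wt_cat wt_word wt_cons addn0. Qed.

Lemma lab_mod c t s : lab c t (s %% (tsize t).*2.+1) = lab c t s.
Proof.
by rewrite /lab (_ : _.+1 = size (rcons (word t) c)) ?shift_mod // size_rcons size_word.
Qed.

Lemma lab_eq c t t' s s' : tsize t = tsize t' -> lab c t s = lab c t' s' ->
  t = t' /\ s = s' %[mod (tsize t).*2.+1].
Proof.
move=> szt; rewrite -lab_mod -[in RHS]lab_mod -szt.
have := ltn_mod s (tsize t).*2.+1; have := ltn_mod s' (tsize t).*2.+1.
move: (s %% _) (s' %% _) => {s s'} s s' lt_s' lt_s.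
wlog le_s : t t' s s' szt lt_s lt_s' / s' <= s => [base|].
  have [/base|/ltnW/base base'] := leqP s' s; first by apply.
  move=> /esym /base' []; rewrite -?szt //.
rewrite /lab -(subnKC le_s) shift_add => /shift_inj /esym eq_l.
have le : s - s' <= (tsize t).*2 by lia.
rewrite shift_rotr ?size_rcons ?size_word 1?leqW // in eq_l.
have s0 := word_rotr le eq_l; rewrite s0 addn0; split=> //.
move: eq_l; rewrite s0 /rotr subn0 rot_size => /rcons_inj[] /word_inj //.
Qed.

Lemma adj_lab t s : adj (lab false t s) (lab true t s).
Proof. by rewrite adj_shift ?size_rcons // -!cats1 adj_cat adj_head. Qed.

(** For [t = Node u v], the rotated word followed by 1 and turned by one place reads [1 u 1 v 0],
    against [1 u 0 v 0] for [t] itself. *)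
Lemma adj_lab_rho t s : 0 < tsize t -> adj (lab false t s) (lab true (rho t) s.+1).
Proof.
case: t => // u v _; rewrite /lab /shift iterSr -/(shift _ _) -/(shift _ _).
rewrite adj_shift ?size_rotr ?size_rcons ?size_word ?tsize_rho //.
by rewrite rotr1_rcons /= word_app /= rcons_cat adj_cons adj_cat /= cats1 adj_head.
Qed.

Lemma cat_shift (a b : seq bool) : a ++ b = shift (size a) (b ++ a).
Proof. by rewrite shift_rotr ?rotr_size_cat // size_cat leq_addl. Qed.

Lemma rot_shift i x : exists m, x = shift m (rot i x).
Proof.
have [le_i|lt_i] := leqP i (size x); last by exists 0; rewrite rot_oversize // ltnW.
by exists i; rewrite shift_rotr ?size_rot ?rotK.
Qed.

Lemma true_false_factor w : true \in w ->
  exists a b, rcons w false = a ++ [:: true, false & b].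
Proof.
elim: w => // c w IH; rewrite inE.
have [/IH[a [b eq_w]] _|w_f] := boolP (true \in w).
  by exists (c :: a), b; rewrite /= eq_w.
rewrite orbF => /eqP <-; exists [::].
case: w {IH} w_f => [|[] w] //; first by exists [::].
by exists (rcons w false).
Qed.

(** The existence half of the cycle lemma: a cyclic factor [true, false] is deleted, induction turns
    the rest into a Dyck word with a final [false], and the factor comes back as a leaf. *)
Lemma lab_surj k x : size x = k.*2.+1 -> wt x = k ->
  exists t s, tsize t = k /\ x = lab false t s.
Proof.
elim: k x => [|k IH] x sx wx.
  case: x sx wx => [|c [|? ?]] //= _; rewrite wt_cons addn0 => /eqP; rewrite eqb0.
  by move=> /negPf ->; exists Leaf, 0.
have x_f : false \in x.
  apply/negPn/negP => /count_memPn nf.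
  have := count_predC (pred1 true) x; rewrite -/(wt x) wx sx.
  rewrite (eq_count (a2 := pred1 false)) ?nf; [lia | by case].
have x_t : true \in x by rewrite -has_pred1 has_count -/(wt x) wx.
have [i x' def_x] := rot_to x_f.
have x'_t : true \in x' by move: x_t; rewrite -(mem_rot i) def_x inE.
have [m1 eq1] := rot_shift i x; have [m2 eq2] := rot_shift 1 (false :: x').
have [a [b eq3]] := true_false_factor x'_t.
have [y [m [sy wy eqx]]] : exists y m, [/\ size y = k.*2.+1, wt y = k
    & x = shift m [:: true, false & y]].
  have def_y : x = shift (m1 + m2 + size a) ([:: true, false & b] ++ a).
    by rewrite !shift_add -cat_shift -eq3 -rot1_cons -eq2 -def_x -eq1.
  exists (b ++ a), (m1 + m2 + size a); split=> //.
    by move: sx; rewrite def_y size_shift /=; lia.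
  by move: wx; rewrite def_y wt_shift /= !wt_cons; lia.
have [t [s [st eqy]]] := IH _ sy wy.
move: eqy; rewrite -lab_mod st.
have := ltn_mod s k.*2.+1; move: (s %% _) => {}s lt_s.
rewrite /lab shift_rotr ?size_rcons ?size_word ?st 1?ltnW // /rotr /rot.
set P := take _ _; set Q := drop _ _ => eqy.
have : P ++ Q = rcons (word t) false by rewrite cat_take_drop.
have eqx' : x = shift (m + size [:: true, false & Q]) (P ++ [:: true, false & Q]).
  by rewrite shift_add -cat_shift eqx eqy.
(* If [Q] is empty, the factor stands behind the final [false]; turned to the front it becomes a new
   first leaf. Otherwise it is inserted into the Dyck word. *)
case/lastP: Q {eqy} eqx' => [|Q q] eqx'.
  rewrite cats0 => eqP'; exists (Node Leaf t); eexists; split; first by rewrite /= st.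
  by rewrite eqx' cat_shift -shift_add eqP' /=.
rewrite -rcons_cat => /rcons_inj[eq_w eq_q].
have [t' eq_t' st'] := word_insert (esym eq_w).
exists t'; eexists; split; first by rewrite st' st.
by rewrite eqx' /lab eq_t' rcons_cat /= eq_q.
Qed.

(* The cycle of the 2-factor through lab false x 0: two consecutive steps rotate the
   tree once and shift the string by one place. *)
Definition orb (x : tree) (i : nat) : seq bool :=
  let j := if odd i then i./2.+1 else i./2 in lab (odd i) (iter j rho x) j.

Lemma tsize_eq0 t : tsize t = 0 -> t = Leaf. Proof. by case: t. Qed.

Lemma rho_inj : injective rho.
Proof.
move=> t t' eq_r; have szt : tsize t = tsize t' by rewrite -tsize_rho eq_r tsize_rho.
rewrite -(iter_rho t) -(iter_rho t') -szt.
case: (posnP (tsize t)) => [t0|]; last first.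
  by case: (tsize t) => // k _; rewrite doubleS !iterSr eq_r.
by rewrite (tsize_eq0 t0) (tsize_eq0 (t := t')) -?szt.
Qed.

Lemma iter_rho_inj j : injective (iter j rho).
Proof. by elim: j => // j IH x y /rho_inj /IH. Qed.

Lemma iter_rho_mul m t : iter ((tsize t).*2 * m) rho t = t.
Proof. by elim: m => [|m IH]; rewrite ?muln0 // mulnS iterD IH iter_rho. Qed.

(* Rotating a tree has finite order, so it can be undone by rotating further. *)
Lemma iter_rho_undo j t : exists m, iter m rho (iter j rho t) = t.
Proof.
have [t0|t_gt0] := posnP (tsize t).
  rewrite (tsize_eq0 t0).
  by exists 0 => /=; elim: j => //= j ->.
exists ((tsize t).*2 * j - j); rewrite -iterD subnK ?iter_rho_mul //.
by rewrite leq_pmull // double_gt0.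
Qed.

Lemma wt_orb x i : wt (orb x i) = tsize x + odd i.
Proof. by rewrite wt_lab tsize_iter_rho. Qed.

Lemma orb_even x j : orb x j.*2 = lab false (iter j rho x) j.
Proof. by rewrite /orb odd_double doubleK. Qed.

Lemma orb_odd x j : orb x j.*2.+1 = lab true (iter j.+1 rho x) j.+1.
Proof. by rewrite /orb /= odd_double uphalf_double. Qed.

Lemma adj_orb x i : 0 < tsize x -> adj (orb x i) (orb x i.+1).
Proof.
move=> x_gt0; rewrite -(odd_double_half i); case: (odd i); rewrite ?add0n ?add1n.
  by rewrite -doubleS orb_odd orb_even adj_sym adj_lab.
by rewrite orb_odd orb_even adj_lab_rho // tsize_iter_rho.
Qed.

Lemma orb_periodic x p : orb x p.*2 = orb x 0 ->
  iter p rho x = x /\ (tsize x).*2.+1 %| p.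
Proof.
rewrite orb_even => /lab_eq; rewrite tsize_iter_rho => -[] //= -> eq_p.
by split=> //; apply/eqP; rewrite eq_p mod0n.
Qed.

Lemma orb_add x p i : orb x p.*2 = orb x 0 -> orb x (i + p.*2) = orb x i.
Proof.
move=> /orb_periodic[per div_p].
rewrite /orb oddD odd_double addbF halfD odd_double andbF add0n doubleK.
have eq_lab c a : lab c (iter (a + p) rho x) (a + p) = lab c (iter a rho x) a.
  rewrite iterD per -lab_mod -[RHS]lab_mod tsize_iter_rho.
  by rewrite -modnDmr (eqP div_p) addn0.
by case: (odd i); rewrite -?addSn eq_lab.
Qed.

(** A period exists since 2k rotations restore the tree and 2k+1 shifts the string. Within the least
    one nothing repeats: the weight shows the parity of the index, and equal vertices at indices of
    the same parity would give a smaller period. *)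
Lemma orb_period x : exists p, [/\ 0 < p, (tsize x).*2.+1 %| p,
  forall i, orb x (i + p.*2) = orb x i
  & forall i j, i < p.*2 -> j < p.*2 -> orb x i = orb x j -> i = j].
Proof.
have : exists p, (0 < p) && (orb x p.*2 == orb x 0).
  have [x0|x_gt0] := posnP (tsize x).
    rewrite (tsize_eq0 x0).
    by exists 1.
  exists ((tsize x).*2 * (tsize x).*2.+1).
  rewrite muln_gt0 double_gt0 x_gt0 orb_even iter_rho_mul.
  by rewrite -lab_mod modnMl eqxx.
move=> /ex_minnP[p /andP[p_gt0 /eqP per_p] min_p].
have [_ div_p] := orb_periodic per_p.
exists p; split=> // [i|]; first exact: orb_add.
move=> i j; wlog le_ij : i j / i <= j => [base|] lt_i lt_j.
  by have [/base|/ltnW/base base' /esym /base' ->] := leqP i j; first by apply.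
move=> eq_ij; have oij : odd i = odd j.
  by have := congr1 wt eq_ij; rewrite !wt_orb => /addnI; case: (odd i) (odd j) => [] [].
have le_half : i./2 <= j./2 by exact: half_leq.
have : orb x (j./2 - i./2).*2 = orb x 0.
  move: eq_ij; rewrite /orb -oij odd_double doubleK /=.
  have shiftI a b : lab (odd i) (iter a rho x) a = lab (odd i) (iter b rho x) b ->
     a <= b -> lab false (iter (b - a) rho x) (b - a) = lab false x 0.
    move=> /lab_eq; rewrite !tsize_iter_rho => -[] // eq_t eq_m le_ab.
    have -> : iter (b - a) rho x = x.
      by apply: (@iter_rho_inj a); rewrite -iterD subnKC.
    rewrite -lab_mod; congr lab; apply/eqP; rewrite -/(_ %| _).
    by rewrite -eqn_mod_dvd // eq_m.
  case: (odd i) shiftI => shiftI /shiftI; last exact.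
  by rewrite subSS; apply.
move=> /eqP per; have := min_p (j./2 - i./2); rewrite per andbT.
case: posnP => [eq0 _|_ /(_ isT) le_p]; last by lia.
by rewrite -(odd_double_half i) -(odd_double_half j) oij; lia.
Qed.

(** * Pulling leaves and gluing the cycles of the 2-factor *)

Definition pull_src u v := Node (Node Leaf u) v.
Definition pull_tgt u v := Node Leaf (Node u v).

(** A leaf that is the first child of its parent becomes the sibling just before that parent,
    anywhere in the tree. *)
Inductive pull : tree -> tree -> Prop :=
| PullRoot u v : pull (pull_src u v) (pull_tgt u v)
| PullLeft u u' v : pull u u' -> pull (Node u v) (Node u' v)
| PullRight u v v' : pull v v' -> pull (Node u v) (Node u v').

Lemma tsize_pull t t' : pull t t' -> tsize t' = tsize t.
Proof. by elim=> /= [u v|u u' v _ ->|u v v' _ ->]; lia. Qed.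

Lemma area_pull t t' : pull t t' -> area t' < area t.
Proof.
elim=> /= [u v|u u' v /tsize_pull -> ?|u v v' _ ?]; lia.
Qed.

(** The same number of rotations puts both trees into the form where the pull happens at the root,
    which is where the 6-cycle is available. The extra [r] collects what the rotations have moved to
    the end. *)
Lemma pull_rotate t t' r : pull t t' -> exists j u v,
  iter j rho (app t r) = pull_src u v /\ iter j rho (app t' r) = pull_tgt u v.
Proof.
move=> pull_t; elim: pull_t r => [u v|u u' v _ IH|u v v' pull_v IH] r.
- by exists 0, u, (app v r).
- have [j [a [b [eq1 eq2]]]] := IH (Node (app v r) Leaf).
  by exists (j + 1), a, b; rewrite !iterD.
have [j [a [b [eq1 eq2]]]] := IH (app r (Node u Leaf)).
exists (j + (tsize (Node u Leaf)).*2), a, b.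
have rot w : iter (tsize (Node u Leaf)).*2 rho (app (Node u w) r) =
             app w (app r (Node u Leaf)).
  rewrite -[app (Node u w) r]/(app (Node u Leaf) (app w r)).
  by rewrite iter_rho_app appA.
by rewrite !iterD !rot.
Qed.

Definition star k := iter k (Node Leaf) Leaf.

Lemma tsize_star k : tsize (star k) = k.
Proof. by elim: k => //= k ->. Qed.

Lemma star_or_pull t : t = star (tsize t) \/ exists t', pull t t'.
Proof.
elim: t => [|u IHu v IHv]; first by left.
case: u IHu => [_|a b [eq_u|[u' pull_u]]].
- case: IHv => [eq_v|[v' pull_v]].
    by left; rewrite {1}eq_v.
  by right; exists (Node Leaf v'); apply: PullRight.
- by case: a eq_u => // _; right; exists (pull_tgt b v); apply: PullRoot.
- by right; exists (Node u' v); apply: PullLeft.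
Qed.

Definition edge_kept (s : seq (seq bool)) t :=
  cedge s (lab false t 0) (lab true (rho t) 1).

(** By [good_closed] the vertex set is a union of cycles of the 2-factor. Where a cycle may still be
    attached, at a target on [s] whose source is missing, [good_edge] preserves the edge of the
    2-factor that the gluing replaces. *)
Record good (k : nat) (s : seq (seq bool)) : Prop := Good {
  good_cycle : ucycle adj s;
  good_range : forall z, z \in s -> exists b t i, tsize t = k /\ z = lab b t i;
  good_closed : forall b t i c j i', tsize t = k -> lab b t i \in s ->
    lab c (iter j rho t) i' \in s;
  good_edge : forall u v, tsize (pull_src u v) = k ->
    lab false (pull_tgt u v) 0 \in s -> lab false (pull_src u v) 0 \notin s ->
    edge_kept s (pull_tgt u v) }.

Definition orbit_seq x p : seq (seq bool) := map (orb x) (iota 0 p.*2).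

(** Another 2k rotations restore the tree but change the shift by -1 modulo 2k+1, so the cycle meets
    all shifts of all rotations of [x], with either final bit. *)
Lemma mem_orbit_seq x p c j i : 0 < tsize x -> 0 < p ->
  (forall i, orb x (i + p.*2) = orb x i) ->
  lab c (iter j rho x) i \in orbit_seq x p.
Proof.
set k := tsize x => x_gt0 p_gt0 per.
have mem m : orb x m \in orbit_seq x p.
  apply/mapP; exists (m %% p.*2); first by rewrite mem_iota ltn_mod double_gt0.
  rewrite {1}(divn_eq m p.*2); elim: (m %/ _) => // q IH.
  by rewrite mulSn -addnA addnC per IH.
(* Since 2k = -1 modulo 2k+1, this is congruent to i modulo 2k+1. *)
pose a := j + k.*2 * (j + i * k.*2 + k.*2.+1).
have eq_a : lab c (iter a rho x) a = lab c (iter j rho x) i.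
  rewrite /a iterD iter_rho_mul -lab_mod -[RHS]lab_mod tsize_iter_rho -/k.
  congr (lab _ _ _); rewrite (_ : j + _ = i + (j + i * (k.*2.-1) + k.*2) * k.*2.+1).
    by rewrite addnC modnMDl.
  have: 0 < k.*2 by rewrite double_gt0.
  by case: k.*2 => // h _ /=; nia.
have a_gt0 : 0 < a by rewrite addn_gt0 muln_gt0 double_gt0 x_gt0 addnS orbT.
rewrite -eq_a; case: c {eq_a}; last by rewrite -orb_even.
by rewrite -(prednK a_gt0) -orb_odd.
Qed.

Lemma orbit_seqP x p z : z \in orbit_seq x p ->
  exists c j, z = lab c (iter j rho x) j.
Proof. by case/mapP => m _ ->; exists (odd m); eexists. Qed.

Lemma lab_closed_inv k s b t i c j i' : good k s -> tsize t = k ->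
  lab b (iter j rho t) i \in s -> lab c t i' \in s.
Proof.
move=> gs szt; have [m {2}<-] := iter_rho_undo j t.
by apply: (good_closed gs); rewrite tsize_iter_rho.
Qed.


Lemma steps_iota (T : Type) (f : nat -> T) i m :
  steps (f i) (map f (iota i.+1 m)) = [seq (f a, f a.+1) | a <- iota i m].
Proof. by elim: m i => //= m IH i; rewrite IH. Qed.

Lemma csteps_iota (T : Type) (f : nat -> T) m : f m = f 0 ->
  csteps (map f (iota 0 m)) = [seq (f a, f a.+1) | a <- iota 0 m].
Proof.
case: m => // m fm; rewrite -steps_iota -[m.+1 in RHS]addn1 iotaD map_cat /= fm cats1.
by [].
Qed.

Lemma uniq_orbit_seq x p :
  (forall i j, i < p.*2 -> j < p.*2 -> orb x i = orb x j -> i = j) ->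
  uniq (orbit_seq x p).
Proof.
move=> inj; rewrite map_inj_in_uniq ?iota_uniq // => i j.
by rewrite !mem_iota; exact: inj.
Qed.

Lemma orb_closed x p b t i c j i' : 0 < tsize x -> 0 < p ->
  (forall i, orb x (i + p.*2) = orb x i) ->
  tsize t = tsize x -> lab b t i \in orbit_seq x p ->
  lab c (iter j rho t) i' \in orbit_seq x p.
Proof.
move=> x_gt0 p_gt0 per szt /orbit_seqP[c' [j' eq_l]].
have eq_c : b = c'.
  have := congr1 wt eq_l; rewrite !wt_lab tsize_iter_rho szt => /addnI.
  by case: (b) (c') => [] [].
move: eq_l; rewrite eq_c => /lab_eq[|-> _]; first by rewrite tsize_iter_rho szt.
by rewrite -iterD; exact: mem_orbit_seq.
Qed.

Lemma orb_edge x t i : tsize t = tsize x -> lab false t 0 = orb x i ->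
  exists h, [/\ i = h.*2, t = iter h rho x & lab true (rho t) 1 = orb x h.*2.+1].
Proof.
move=> szt eq_t; exists i./2.
have def_i : i = i./2.*2.
  have := congr1 wt eq_t; rewrite wt_lab wt_orb szt => /addnI.
  by rewrite -{2}(odd_double_half i); case: (odd i).
move: eq_t; rewrite {1}def_i orb_even => /lab_eq[|eq_t eq_m]; first by rewrite tsize_iter_rho.
split=> //; rewrite orb_odd eq_t -iterS -[LHS]lab_mod -[RHS]lab_mod tsize_iter_rho.
congr lab; rewrite eq_t tsize_iter_rho in eq_m.
by apply/eqP; rewrite -[1]/(0 + 1) -[i./2.+1]addn1 eqn_modDr; apply/eqP.
Qed.

Lemma good_star k : 0 < k ->
  exists2 s, good k s & lab false (star k) 0 \in s.
Proof.
move=> k_gt0; set x := star k; have szx : tsize x = k by exact: tsize_star.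
have x_gt0 : 0 < tsize x by rewrite szx.
have [p [p_gt0 div_p per inj]] := orb_period x.
have cE : csteps (orbit_seq x p) = [seq (orb x i, orb x i.+1) | i <- iota 0 p.*2].
  by apply: csteps_iota; exact: (per 0).
exists (orbit_seq x p); last exact: (mem_orbit_seq false 0).
split.
- rewrite /ucycle uniq_orbit_seq // andbT cycle_csteps cE.
  by apply/allP => _ /mapP[i _ ->]; exact: adj_orb.
- move=> z /orbit_seqP[c [j ->]]; exists c; do 2 eexists; split; last by [].
  by rewrite tsize_iter_rho.
- by move=> b t i c j i' szt; apply: orb_closed; rewrite ?szx.
move=> u v sz /mapP[i]; rewrite mem_iota add0n => lt_i eq_y _.
have [|h [def_i _ eq_r]] := orb_edge _ eq_y; first by rewrite szx -sz /=; lia.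
rewrite /edge_kept /cedge cE eq_y eq_r def_i.
by rewrite (map_f (fun i => (orb x i, orb x i.+1))) // mem_iota -def_i.
Qed.

(** Without the edges 01 and 56 the cycle of [x], of length [7 + m], falls into the paths 1, ..., 5
    and 6, ..., 0. The first is run backwards and linked to the second by the edge 16. *)
Definition detour m := [:: 5; 4; 3; 2; 1] ++ iota 6 m.+1 ++ [:: 0].

Lemma steps_detour (T : Type) (f : nat -> T) m u v :
  steps u (rcons (map f (detour m)) v) =
  [:: (u, f 5); (f 5, f 4); (f 4, f 3); (f 3, f 2); (f 2, f 1); (f 1, f 6)] ++
  [seq (f a, f a.+1) | a <- iota 6 m] ++ [:: (f (6 + m), f 0); (f 0, v)].
Proof.
rewrite /= !map_cat rcons_cat steps_cat steps_iota /=.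
suff -> : last (f 6) (map f (iota 7 m)) = f (6 + m) by [].
by rewrite last_map; congr f; elim: m 6 => [|m IH] i /=; rewrite ?addn0 // IH addnS.
Qed.

(* Together with the edge of the 2-factor at y, these three edges and the edges
   (orb x 0, orb x 1), (orb x 5, orb x 6) form a 6-cycle. Taking its symmetric difference
   with the 2-factor joins the two cycles through x and y. *)
Lemma glue_adj u v : let x := pull_src u v in let y := pull_tgt u v in
  [/\ adj (lab false y 0) (orb x 5), adj (orb x 0) (lab true (rho y) 1)
    & adj (orb x 1) (orb x 6)].
Proof.
have shift_rcons c n (a b : seq bool) : size a = n ->
    shift n.+1 (rcons (b ++ a) c) = a ++ c :: b.
  by move=> <-; rewrite -cat_rcons [RHS]cat_shift size_rcons rcons_cat.
rewrite /= /orb /lab /= !word_app /=; set w := word u ++ _ :: _ ++ _.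
have shift3 c : shift 3 (rcons (w ++ [:: true; false]) c) = [:: true, false, c & w].
  exact: (shift_rcons c 2 [:: true; false]).
have shift1 c z : shift 1 (rcons z c) = c :: z by rewrite /shift /= rotr1_rcons.
rewrite -!rcons_cons !shift1 !shift3 /shift /w /= -!cats1 -!catA /=.
by rewrite !adj_cons adj_cat !adj_head.
Qed.

(** The point is that [good_edge] survives. At [y] it is no longer required, as the source [x] is
    now present; at other old targets nothing changes; on the cycle of [x] the edge in question
    joins positions 2h and 2h+1, so it is not the dropped edge 56. *)
Lemma good_glue k s u v : good k s -> tsize (pull_src u v) = k ->
  lab false (pull_tgt u v) 0 \in s -> lab false (pull_src u v) 0 \notin s ->
  exists s', [/\ good k s', {subset s <= s'} & size s < size s'].
Proof.
move=> gs; set x := pull_src u v; set y := pull_tgt u v => szx ys xs.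
have szy : tsize y = k by rewrite -szx /=; lia.
have x_gt0 : 0 < tsize x by [].
have [p [p_gt0 div_p per inj]] := orb_period x.
have [m eq_p] : exists m, p.*2 = 6 + m.+1.
  (* [x] has at least two edges, and 2k+1 divides the period. *)
  have le_p : 5 <= p by apply: leq_trans (dvdn_leq p_gt0 div_p); rewrite /=; lia.
  by exists (p.*2 - 7); lia.
have [adj_y5 adj_01 adj_16] := glue_adj u v; rewrite -/x -/y in adj_y5 adj_01 adj_16.
have adjS i : adj (orb x i) (orb x i.+1) by exact: adj_orb.
have permL : perm_eq (detour m) (iota 0 p.*2).
  by rewrite eq_p iotaD /detour catA perm_catC catA perm_cat2r.
have permP : perm_eq (map (orb x) (detour m)) (orbit_seq x p) by exact: perm_map.
have dis z : z \in orbit_seq x p -> z \notin s.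
  case/orbit_seqP => c [j ->]; apply: contra xs => zs.
  exact: (lab_closed_inv false 0 gs szx zs).
have edge_y : cedge s (lab false y 0) (lab true (rho y) 1) by exact: (good_edge gs).
have pathP : path adj (lab false y 0) (rcons (map (orb x) (detour m)) (lab true (rho y) 1)).
  rewrite path_steps steps_detour all_cat all_cat.
  apply/and3P; split; last 2 first.
  - by apply/allP => _ /mapP[i _ ->]; exact: adjS.
  - rewrite [all _ _]/= adj_01 andbT -(per 0) add0n eq_p addnS adjS //.
  rewrite [all _ _]/= adj_y5 adj_16 !andbT.
  have adjS' i : adj (orb x i.+1) (orb x i) by rewrite adj_sym.
  by rewrite !adjS'.
have [||s' [cyc' perm' keep new]] := attach adj_sym (good_cycle gs) edge_y pathP.
- by rewrite (perm_uniq permP) uniq_orbit_seq.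
- by apply/hasPn => z; rewrite (perm_mem permP); exact: dis.
have mem' z : (z \in s') = (z \in s) || (z \in orbit_seq x p).
  by rewrite (perm_mem perm') mem_cat (perm_mem permP).
exists s'; split.
- split=> //.
  + move=> z; rewrite mem' => /orP[/(good_range gs) //|/orbit_seqP[c [j ->]]].
    by exists c, (iter j rho x), j; rewrite tsize_iter_rho.
  + move=> b t i c j i' szt; rewrite !mem' => /orP[zs|zo].
      by apply/orP; left; apply: (good_closed gs) zs.
    by apply/orP; right; apply: orb_closed zo => //; rewrite szt.
  move=> u' v' szx'; rewrite !mem' negb_or => y's /andP[x's x'o].
  have szy' : tsize (pull_tgt u' v') = k by rewrite (tsize_pull (PullRoot _ _)).
  case/orP: y's => [y's|/mapP[i]].
    apply: keep; first exact: (good_edge gs).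
    apply/negP => /orP[] /andP[/eqP eq_y _].
      have [|[eq_u eq_v] _] := @lab_eq false (pull_tgt u' v') y 0 0 _ eq_y.
        by rewrite szy'.
      by move: x'o; rewrite eq_u eq_v (mem_orbit_seq false 0).
    by have := congr1 wt eq_y; rewrite !wt_lab szy' tsize_rho szy => /addnI.
  rewrite mem_iota add0n => lt_i eq_y.
  have [|h [def_i eq_t eq_r]] := orb_edge _ eq_y; first by rewrite szy'.
  rewrite /edge_kept eq_y eq_r def_i; rewrite def_i eq_p in lt_i.
  have steps_in a b : (a, b) \in steps (lab false y 0)
      (rcons (map (orb x) (detour m)) (lab true (rho y) 1)) -> cedge s' a b.
    exact: new.
  rewrite steps_detour in steps_in.
  case: h {eq_r} eq_t def_i lt_i => [|[|[|h]]] eq_t def_i lt_i.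
  (* Position 0 is [x], a source and never a target, so the dropped edge 01 is not asked for
     either. *)
  - by [].
  - by rewrite cedgeC; apply: steps_in; rewrite !inE !eqxx !orbT.
  - by rewrite cedgeC; apply: steps_in; rewrite !inE !eqxx !orbT.
  apply: steps_in; rewrite !mem_cat (map_f (fun i => (orb x i, orb x i.+1))) ?orbT //.
  by rewrite mem_iota; clear -lt_i eq_p; lia.
- by move=> z zs; rewrite mem' zs.
- rewrite (perm_size perm') size_cat (perm_size permP) size_map size_iota.
  by rewrite -[X in X < _]addn0 ltn_add2l double_gt0.
Qed.

(** Pulls lower the area and can only stop at the star, which is on [s]. So some pull leads from a
    missing tree to a tree on [s], and rotation moves it to the root. *)
Lemma exists_glue k s t : good k s -> lab false (star k) 0 \in s ->
  tsize t = k -> lab false t 0 \notin s ->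
  exists u v, [/\ tsize (pull_src u v) = k, lab false (pull_tgt u v) 0 \in s
                & lab false (pull_src u v) 0 \notin s].
Proof.
move=> gs ss; have [m] := ubnP (area t); elim: m t => // m IH t lt_m szt t_s.
have [eq_t|[t' pull_t]] := star_or_pull t.
  by move: t_s; rewrite eq_t szt ss.
have [t'_s|t'_s] := boolP (lab false t' 0 \in s); last first.
  apply: IH t'_s; last by rewrite (tsize_pull pull_t).
  exact: leq_trans (area_pull pull_t) lt_m.
have [j [u [v [eq1 eq2]]]] := pull_rotate Leaf pull_t; rewrite !app_leaf in eq1 eq2.
exists u, v; rewrite -eq1 -eq2; split.
- by rewrite tsize_iter_rho.
- by apply: (good_closed gs) t'_s; rewrite (tsize_pull pull_t).
by apply: contra t_s; exact: (lab_closed_inv false 0 gs szt).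
Qed.

(** * Cycles saturating a level *)

Definition between (n i : nat) (s : seq (seq bool)) : Prop :=
  {in s, forall z, size z = n /\ i <= wt z <= i.+1}.

Lemma good_between k s : good k s -> between k.*2.+1 k s.
Proof.
move=> gs z /(good_range gs)[b [t [i [szt ->]]]].
by rewrite size_lab wt_lab szt; case: b; rewrite ?addn0 ?addn1 !leqnn !leqnSn.
Qed.

Lemma between_size n i s : uniq s -> between n i s -> size s <= 'C(n, i) + 'C(n, i.+1).
Proof.
move=> us bs; rewrite -!size_lev -size_cat; apply: uniq_leq_size => // z /bs[sz wz].
by rewrite mem_cat !mem_lev sz eqxx /=; lia.
Qed.

Lemma middle_cycle k : 0 < k -> exists s,
  [/\ ucycle adj s, between k.*2.+1 k s & {subset lev k.*2.+1 k <= s}].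
Proof.
move=> k_gt0; have [s0 g0 star0] := good_star k_gt0.
pose M := 'C(k.*2.+1, k) + 'C(k.*2.+1, k.+1).
have [m] := ubnP (M - size s0); elim: m s0 g0 star0 => // m IH s gs ss lt_m.
have [/allP sub|] := boolP (all [in s] (lev k.*2.+1 k)).
  exists s; split=> //; [exact: good_cycle gs | exact: good_between].
case/allPn => x; rewrite mem_lev => /andP[/eqP sx /eqP wx] x_s.
have [t [i [szt eq_x]]] := lab_surj sx wx.
have t_s : lab false t 0 \notin s.
  by apply: contra x_s; rewrite eq_x => /(good_closed gs false 0 i szt).
have [u [v [szu tgt_s src_s]]] := exists_glue gs ss szt t_s.
have [s' [gs' sub' lt_s']] := good_glue gs szu tgt_s src_s.
apply: (IH s') => //; first exact: sub'.
have /andP[_ us'] := good_cycle gs'.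
have := between_size us' (good_between gs'); rewrite -/M => le_s'.
exact: leq_trans (ltn_sub2l (leq_trans lt_s' le_s') lt_s') lt_m.
Qed.

Lemma next_mem_adj s z : ucycle adj s -> z \in s -> adj z (next s z).
Proof. by case/andP => cyc _ zs; exact: next_cycle. Qed.

Lemma next_inj (T : eqType) (s : seq T) : uniq s -> injective (next s).
Proof. by move=> us; exact: can_inj (prev_next us). Qed.

(** Passing to the successor on the cycle is a bijection that exchanges the two levels. *)
Lemma half_count n i s : ucycle adj s -> between n i s ->
  count (fun z => wt z == i) s = count (fun z => wt z == i.+1) s.
Proof.
move=> cyc bs; have /andP[_ us] := cyc.
have next_wt z : z \in s -> (wt z == i.+1) = (wt (next s z) == i).
  move=> zs; have nzs : next s z \in s by rewrite mem_next.
  have := adj_wt (next_mem_adj cyc zs); have [_] := bs _ zs; have [_] := bs _ nzs; lia.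
have -> : count (fun z => wt z == i.+1) s = count (fun z => wt z == i) (map (next s) s).
  by rewrite count_map; apply: eq_in_count => z zs; rewrite next_wt.
apply/permP; apply: uniq_perm => //; first by rewrite map_inj_uniq //; exact: next_inj.
move=> z; apply/idP/mapP => [zs|[y ys ->]]; last by rewrite mem_next.
by exists (prev s z); rewrite ?mem_prev ?next_prev.
Qed.

Lemma saturated_size n i s : ucycle adj s -> between n i s ->
  {subset lev n i <= s} -> size s = 2 * 'C(n, i).
Proof.
move=> cyc bs sub; have /andP[_ us] := cyc.
have c1 : count (fun z => wt z == i) s = 'C(n, i).
  rewrite -size_lev -size_filter; apply/perm_size/uniq_perm.
  - exact: filter_uniq.
  - exact: lev_uniq.
  move=> z; rewrite mem_filter mem_lev; apply/andP/andP => [[-> /bs[-> _]] //|[sz wz]].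
  by split=> //; apply: sub; rewrite mem_lev sz.
rewrite -(count_predC (fun z => wt z == i)) c1 mul2n -addnn; congr (_ + _).
rewrite -c1 (half_count cyc bs); apply: eq_in_count => z /bs[_] /=; lia.
Qed.

Lemma saturated n i s : ucycle adj s -> between n i s -> size s = 2 * 'C(n, i) ->
  {subset lev n i <= s}.
Proof.
move=> cyc bs sz; have /andP[_ us] := cyc.
have cF : size ([seq z <- s | wt z == i]) = 'C(n, i).
  have := sz; rewrite size_filter -(count_predC (fun z => wt z == i)).
  rewrite (eq_in_count (a1 := predC _) (a2 := fun z => wt z == i.+1)).
    by rewrite -(half_count cyc bs); lia.
  by move=> z /bs[_] /=; lia.
have subF : {subset [seq z <- s | wt z == i] <= lev n i}.
  by move=> z; rewrite mem_filter mem_lev => /andP[-> /bs[-> _]]; rewrite eqxx.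
have [|_ eqF] := uniq_min_size (filter_uniq _ us) subF.
  by rewrite cF size_lev.
by move=> z; rewrite -eqF mem_filter => /andP[].
Qed.

Lemma ucycle_act n Is s : perm_eq Is (iota 0 n) -> {in s, forall z, size z = n} ->
  ucycle adj s -> ucycle adj (map (act Is) s).
Proof.
move=> pI sz /andP[cyc us]; rewrite /ucycle map_inj_in_uniq ?us ?andbT; last first.
  by move=> x y /sz sx /sz sy; apply: (act_inj pI); rewrite inE ?sx ?sy.
have mono : {in s &, {mono act Is : x y / adj x y}}.
  by move=> x y /sz sx /sz sy; rewrite (act_adj sx sy pI).
by rewrite (mono_cycle_in mono) //; apply/allP => x.
Qed.

Lemma cedge_next (T : eqType) (s : seq T) x : uniq s -> x \in s -> cedge s x (next s x).
Proof.
move=> us /rot_to[i p def_s]; rewrite -(cedge_rot i) -(next_rot i us) def_s.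
by case: p {def_s} => [|y p]; rewrite /cedge /= ?eqxx inE eqxx.
Qed.

Lemma ucycle_open3 (T : eqType) (e : rel T) (s : seq T) w :
  ucycle e s -> w \in s -> 2 < size s ->
  exists x y p, perm_eq (w :: x :: rcons p y) s /\ ucycle e (w :: x :: rcons p y).
Proof.
move=> cyc /rot_to[i p def_s]; rewrite -(size_rot i) def_s => sz.
have perm : perm_eq (w :: p) s by rewrite -def_s perm_rot.
move: cyc; rewrite -(rot_ucycle i) def_s.
case: p perm sz {def_s} => [|x p] //; case/lastP: p => [|p y] // perm _ cyc.
by exists x, y, p.
Qed.

Lemma lower_neighbour z j : wt z = j.+1 -> exists q, adj q z /\ wt q = j.
Proof.
elim: z j => [|[] z IH] j //; rewrite wt_cons ?add1n ?add0n.
  by case=> eq_j; exists (false :: z); rewrite adj_head wt_cons eq_j.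
by move=> /IH[q [aq wq]]; exists (false :: q); rewrite adj_cons wt_cons wq.
Qed.

Lemma ltn_bin n i : i.*2.+2 <= n -> 'C(n, i) < 'C(n, i.+1).
Proof.
move=> le_n; have := mul_bin_left n i; have : 0 < 'C(n, i) by rewrite bin_gt0; lia.
by move: ('C(n, i)) ('C(n, i.+1)) => a b; nia.
Qed.

Lemma leq_bin n i : i.*2.+1 <= n -> 'C(n, i) <= 'C(n, i.+1).
Proof.
move=> le_n; have := mul_bin_left n i.
by move: ('C(n, i)) ('C(n, i.+1)) => a b; nia.
Qed.

Lemma between_lower n i s x y : between n i s -> x \in s -> y \in s -> adj x y ->
  wt x = i.+1 -> wt y = i.
Proof. by move=> bs xs ys /adj_wt; have [_] := bs _ ys; lia. Qed.

Lemma between_upper n i s x y : between n i s -> x \in s -> y \in s -> adj x y ->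
  wt x = i -> wt y = i.+1.
Proof. by move=> bs xs ys /adj_wt; have [_] := bs _ ys; lia. Qed.

Lemma wt_nseq0 n : wt (nseq n false) = 0.
Proof. by elim: n. Qed.

Lemma nseq_cycle n : ucycle adj [:: nseq n.+1 false; true :: nseq n false].
Proof. by rewrite /ucycle /= !adj_head. Qed.

Lemma ucycle_map (T T' : eqType) (e : rel T) (e' : rel T') (f : T -> T') s :
  injective f -> {mono f : x y / e x y >-> e' x y} -> ucycle e s ->
  ucycle e' (map f s).
Proof. by move=> inj mono; rewrite /ucycle map_inj_uniq // (mono_cycle mono). Qed.

(* The copy of C1 makes a detour through C0 with one upper vertex w deleted, returning over
   a vertex z' that C1 misses. Permuting the coordinates of C0 moves the two neighbours of w
   to z and z', which have a common neighbour q such that qz is an edge of C1. *)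
Lemma saturating_step m i (C0 C1 : seq (seq bool)) : i.+1.*2.+1 <= m ->
  ucycle adj C0 -> between m i.+1 C0 -> size C0 = 2 * 'C(m, i.+1) ->
  ucycle adj C1 -> between m i C1 -> size C1 = 2 * 'C(m, i) ->
  exists s, [/\ ucycle adj s, between m.+1 i.+1 s & size s = 2 * 'C(m.+1, i.+1)].
Proof.
move=> le_m cyc0 b0 sz0 cyc1 b1 sz1; have /andP[_ u1] := cyc1.
have sat0 := saturated cyc0 b0 sz0; have sat1 := saturated cyc1 b1 sz1.
(* Level [i.+1] is strictly larger than level [i], while [C1] visits equally many vertices of
   both. *)
have [z' z'_lev z'_C1] : exists2 z', z' \in lev m i.+1 & z' \notin C1.
  apply/allPn; apply/negP => /allP sub.
  have : size (lev m i.+1) <= size ([seq z <- C1 | wt z == i.+1]).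
    apply: uniq_leq_size (lev_uniq _ _) _ => z z_lev; rewrite mem_filter sub // andbT.
    by move: z_lev; rewrite mem_lev => /andP[].
  rewrite size_lev size_filter -(half_count cyc1 b1).
  have lt_bin := @ltn_bin m i; have := count_predC (fun z => wt z == i) C1.
  rewrite (eq_in_count (a1 := predC _) (a2 := fun z => wt z == i.+1)); last first.
    by move=> z /b1[_] /=; lia.
  rewrite -(half_count cyc1 b1) sz1; lia.
have /andP[/eqP sz' /eqP wz'] : (size z' == m) && (wt z' == i.+1) by rewrite -mem_lev.
have [q [adj_qz' wq]] := lower_neighbour wz'.
have sq : size q = m by rewrite (adj_size adj_qz').
have q1 : q \in C1 by apply: sat1; rewrite mem_lev sq wq !eqxx.
pose z := next C1 q; have z1 : z \in C1 by rewrite mem_next.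
have adj_qz : adj q z by exact: next_mem_adj.
have wz : wt z = i.+1 by exact: (between_upper b1 q1 z1 adj_qz wq).
have [sz _] := b1 _ z1.
have [w [w0 ww]] : exists w, w \in C0 /\ wt w = i.+2.
  have z'0 := sat0 _ z'_lev; exists (next C0 z'); rewrite mem_next; split=> //.
  by apply: (between_upper b0 z'0 _ (next_mem_adj cyc0 z'0) wz'); rewrite mem_next.
have lt2 : 2 < size C0.
  have := @ltn_bin m i; have : 0 < 'C(m, i) by rewrite bin_gt0; lia.
  by rewrite sz0; lia.
have [x [y [p [perm0 cyc0']]]] := ucycle_open3 cyc0 w0 lt2.
have in0 v : v \in w :: x :: rcons p y -> v \in C0 by rewrite (perm_mem perm0).
have x0 : x \in C0 by apply: in0; rewrite !inE eqxx orbT.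
have y0 : y \in C0 by apply: in0; rewrite !inE mem_rcons mem_head !orbT.
have [sx _] := b0 _ x0; have [sy _] := b0 _ y0.
have /andP[] := cyc0'; rewrite /= rcons_path last_rcons => /and3P[adj_wx path_xy adj_yw].
move=> /and3P[w_p x_p u_p].
have wx : wt x = i.+1 by exact: (between_lower b0 w0 x0 adj_wx ww).
have wy : wt y = i.+1 by apply: (between_lower b0 w0 y0 _ ww); rewrite adj_sym.
have neq_xy : x != y.
  by apply: contra x_p => /eqP->; rewrite mem_rcons mem_head.
have dxy : dist x y = 2 by apply: dist_common adj_wx _ neq_xy; rewrite adj_sym.
have dzz : dist z z' = 2.
  by apply: dist_common adj_qz adj_qz' _; apply: contra z'_C1 => /eqP <-.
have [Is [pI act_x act_y]] := act_transitive sx sy sz sz' (etrans wx (esym wz))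
  (etrans wy (esym wz')) (etrans dxy (esym dzz)).
have szp v : v \in x :: rcons p y -> size v = m.
  by move=> vp; have [] := b0 v _; rewrite ?in0 // inE vp orbT.
pose L := map (cons false) (map (act Is) (x :: rcons p y)).
have inL v : v \in L -> exists b, v = false :: b /\ exists2 a, a \in C0 & b = act Is a.
  by case/mapP => _ /mapP[a a_p ->] ->; exists (act Is a); split=> //; exists a;
    rewrite // in0 // inE a_p orbT.
have uL : uniq L.
  rewrite /L !map_inj_in_uniq ?cons_uniq ?x_p ?u_p //; last by move=> ? ? _ _ [].
  by move=> a b /szp sa /szp sb; apply: (act_inj pI); rewrite inE ?sa ?sb.
have mapE u s : {in s, forall v, size v = m} -> size u = m ->
    path adj (false :: act Is u) (map (cons false) (map (act Is) s)) = path adj u s.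
  elim: s u => //= v s IH u sz_s su.
  have sv : size v = m by rewrite sz_s // mem_head.
  rewrite IH ?sv // => [|t t_s]; last by rewrite sz_s // inE t_s orbT.
  by rewrite adj_cons (act_adj su sv pI).
have pathL : path adj (true :: z) (rcons (rcons L (true :: z')) (true :: q)).
  rewrite !rcons_path last_rcons adj_cons [adj z' q]adj_sym adj_qz' andbT /L /=.
  rewrite !last_map last_rcons act_y adj_head andbT {1}act_x adj_head /= mapE //.
  by move=> v v_p; apply: szp; rewrite inE v_p orbT.
have edge : cedge (map (cons true) C1) (true :: z) (true :: q).
  rewrite cedgeC (_ : true :: z = next (map (cons true) C1) (true :: q)).
    by apply: cedge_next; rewrite ?map_f // map_inj_uniq // => ? ? [].
  by rewrite next_map // => ? ? [].
have cyc1' : ucycle adj (map (cons true) C1).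
  by apply: ucycle_map cyc1 => [? ? []|? ?] //; rewrite adj_cons.
have true_L v : true :: v \notin L by apply/negP => /inL[b [[]]].
have [||s [cyc perm _ _]] := attach adj_sym cyc1' edge pathL.
- by rewrite rcons_uniq uL true_L.
- apply/hasPn => v; rewrite mem_rcons inE => /orP[/eqP->|/inL[b [-> _]]];
    by rewrite /= mem_map_cons ?z'_C1.
exists s; split=> //.
  move=> v; rewrite (perm_mem perm) mem_cat mem_rcons inE.
  case/or3P => [/mapP[a /b1[sa wa] ->]|/eqP->|/inL[b [-> [a /b0[sa wa] ->]]]].
  - by rewrite wt_cons add1n !ltnS /= sa.
  - by rewrite wt_cons wz' /= sz' leqnSn leqnn.
  by rewrite wt_cons (act_wt sa pI) /= (act_size _ pI).
(* Losing [w] and gaining [z'] balance, so the size follows by Pascal's rule. *)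
rewrite (perm_size perm) size_cat size_map sz1 size_rcons !size_map /= binS.
have := perm_size perm0; rewrite sz0 /= => {szp}.
by move: (size (rcons p y)) ('C(m, i)) ('C(m, i.+1)) => a b c eq_a; clear -eq_a; lia.
Qed.

(** The middle levels, [n = 2i + 1], are the boundary of the induction. For [i = 0] the cycle is
    degenerate, an edge listed as its two ends; it is traversed in both directions, so one traversal
    can still be replaced by a detour. *)
Lemma saturating_cycle n i : i.*2.+1 <= n -> exists s,
  [/\ ucycle adj s, between n i s & size s = 2 * 'C(n, i)].
Proof.
elim: n i => // n IH i; rewrite ltnS leq_eqVlt => /orP[/eqP eq_n|lt_n].
  case: (posnP i) eq_n => [->|i_gt0] <-.
    exists [:: [:: false]; [:: true]]; split=> // z.
    by rewrite !inE => /orP[] /eqP ->.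
  have [s [cyc bs sub]] := middle_cycle i_gt0.
  by exists s; split=> //; exact: saturated_size.
case: i lt_n => [_|i lt_n].
  exists [:: nseq n.+1 false; true :: nseq n false]; split=> //; first exact: nseq_cycle.
    move=> z; rewrite !inE => /orP[] /eqP ->; rewrite ?wt_cons /= size_nseq;
      by rewrite ?wt_nseq0 //.
have [s0 [cyc0 b0 sz0]] := IH _ lt_n.
have [|s1 [cyc1 b1 sz1]] := IH i; first by move: lt_n; lia.
exact: saturating_step cyc0 b0 sz0 cyc1 b1 sz1.
Qed.

Lemma between_negb n i s : i < n -> between n (n - i.+1) s ->
  between n i (map (map negb) s).
Proof.
move=> lt_i bs z /mapP[y /bs[sy wy] ->].
by rewrite size_map wt_negb sy; split=> //; lia.
Qed.

(* Above the middle the roles of the two levels are exchanged by complementation. *)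
Lemma level_pair_cycle n i : i < n -> exists s,
  [/\ ucycle adj s, between n i s & size s = 2 * minn 'C(n, i) 'C(n, i.+1)].
Proof.
move=> lt_i; have [le_n|gt_n] := leqP i.*2.+1 n.
  by have /minn_idPl -> := leq_bin le_n; exact: saturating_cycle.
have [|s [cyc bs sz]] := @saturating_cycle n (n - i.+1); first by lia.
exists (map (map negb) s); split.
- apply: ucycle_map cyc; last exact: adj_negb.
  exact/inj_map/negb_inj.
- exact: between_negb.
rewrite size_map sz bin_sub //; congr (2 * _); apply/esym/minn_idPr.
by rewrite -(bin_sub lt_i) -[X in _ <= X](bin_sub (ltnW lt_i)) -(subnSK lt_i) leq_bin //; lia.
Qed.

(** * Joining cycles of consecutive pairs of levels *)

(** [w] and [t] are deleted, and the open ends are linked by the edges from [x] to [b1] and from [y]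
    to [b']. The result is listed from [b3], between [b2] and [b4], because [b3] is to be deleted in
    the next join. *)
Lemma glue_opened (T : eqType) (e : rel T) (w x y t b1 b2 b3 b4 b' : T) p q :
  symmetric e -> ucycle e (w :: x :: rcons p y) ->
  ucycle e [:: t, b1, b2, b3, b4 & rcons q b'] ->
  ~~ has [in x :: rcons p y] [:: b1, b2, b3, b4 & rcons q b'] ->
  e x b1 -> e y b' ->
  let s := b3 :: b2 :: rcons ((b1 :: x :: rcons p y) ++ b' :: rev q) b4 in
  ucycle e s /\ perm_eq s ((x :: rcons p y) ++ [:: b1, b2, b3, b4 & rcons q b']).
Proof.
move=> sym /andP[cM uM] /andP[cB uB] dis xb yb' s.
have perm : perm_eq s ((x :: rcons p y) ++ [:: b1, b2, b3, b4 & rcons q b']).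
  apply/permP => P; rewrite /s -!cats1 /=.
  rewrite !count_cat /= !count_cat /= count_rev.
  move: (P b1 : nat) (P b2 : nat) (P b3 : nat) (P b4 : nat) (P b' : nat) (P x : nat) (P y : nat).
  move: (count P p) (count P q) => *; lia.
split=> //; rewrite /ucycle (perm_uniq perm) cat_uniq dis /=.
move: uM uB; rewrite !cons_uniq => /and3P[_ -> ->] /and5P[_ -> -> -> /andP[-> ->]].
rewrite !andbT; move: cM cB; rewrite /s /= !rcons_path !last_rcons.
move=> /and3P[_ Mxy _] /and5P[_ b12 b23 b34 /andP[Bq _]].
rewrite -rcons_path in Mxy; rewrite -rcons_path in Bq.
have Brev : path e b' (rcons (rev q) b4).
  rewrite -[b'](last_rcons b4 q b') -rev_cons -[b4 :: q](belast_rcons b4 q b') rev_path.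
  by rewrite (@eq_path _ (fun z => e^~ z) e) // => ? ? /=; rewrite sym.
rewrite -rcons_path rcons_cat cat_path Mxy last_rcons /= yb' Brev.
by rewrite [e b3 b2]sym b23 [e b2 b1]sym b12 [e b1 x]sym xb [e b4 b3]sym b34.
Qed.

Definition within (n i j : nat) (s : seq (seq bool)) : Prop :=
  {in s, forall z, size z = n /\ i <= wt z <= j}.

Lemma between_mem n i s : ucycle adj s -> between n i s -> 0 < size s ->
  (exists2 w, w \in s & wt w = i) /\ (exists2 w, w \in s & wt w = i.+1).
Proof.
move=> cyc bs; case: s cyc bs => // z s cyc bs _; set t := z :: s in cyc bs *.
have zt : z \in t by exact: mem_head.
have nt : next t z \in t by rewrite mem_next.
have az := next_mem_adj cyc zt.
have [_ /andP[]] := bs z zt; rewrite leq_eqVlt => /orP[/eqP wz _|lt_i le_i].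
  by split; [exists z|exists (next t z) => //; exact: (between_upper bs zt nt az (esym wz))].
have wz : wt z = i.+1 by apply/eqP; rewrite eqn_leq le_i.
by split; [exists (next t z) => //; exact: (between_lower bs zt nt az wz)|exists z].
Qed.

Lemma opened_facts n i w x y p s : between n i s -> 
  perm_eq (w :: x :: rcons p y) s -> ucycle adj (w :: x :: rcons p y) ->
  [/\ x \in s, y \in s, adj w x, adj w y & x != y].
Proof.
move=> bs perm /andP[]; rewrite /= rcons_path last_rcons => /and3P[wx _ yw].
case/and3P => _ x_p _; split=> //.
- by rewrite -(perm_mem perm) !inE eqxx orbT.
- by rewrite -(perm_mem perm) !inE mem_rcons mem_head !orbT.
- by rewrite adj_sym.
by apply: contra x_p => /eqP->; rewrite mem_rcons mem_head.
Qed.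

(* The vertex w is the one that will be deleted to join the next cycle. *)
Record chain (n i j N : nat) (w x y : seq bool) (p : seq (seq bool)) : Prop := Chain {
  chain_cycle : ucycle adj (w :: x :: rcons p y);
  chain_within : within n i j.+1 (w :: x :: rcons p y);
  chain_size : size (w :: x :: rcons p y) = N;
  chain_top : [/\ wt w = j, wt x = j.+1 & wt y = j.+1] }.

Lemma bin_gt1 n m : 0 < m < n -> 1 < 'C(n, m).
Proof.
case: n m => [|n] [|m] //; rewrite /= ltnS binS => lt_m.
by apply: (@leq_add 1 1); rewrite bin_gt0 // ltnW.
Qed.

Lemma bin_gt2 n m : 2 < n -> 0 < m < n -> 2 < 'C(n, m).
Proof.
case: n m => [|n] [|[|m]] // lt_n; rewrite ?bin1 //= ltnS binS => lt_m.
by rewrite addnC (@leq_add 2 1) ?bin_gt0 // bin_gt1.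
Qed.

Lemma chain_start n i : 0 < i -> i.+1 < n ->
  exists w x y p, chain n i i (2 * minn 'C(n, i) 'C(n, i.+1)) w x y p.
Proof.
move=> i_gt0 lt_n; have [|s [cyc bs sz]] := @level_pair_cycle n i; first by lia.
have sz2 : 2 < size s.
  rewrite sz; suff : 1 < minn 'C(n, i) 'C(n, i.+1) by lia.
  by rewrite leq_min !bin_gt1 //; lia.
have [[w ws ww] _] := between_mem cyc bs (ltnW (ltnW sz2)).
have [x [y [p [perm cyc']]]] := ucycle_open3 cyc ws sz2.
have [xs ys wx wy _] := opened_facts bs perm cyc'.
exists w, x, y, p; split=> //.
- by move=> z; rewrite (perm_mem perm); exact: bs.
- by rewrite (perm_size perm).
by split=> //; [exact: (between_upper bs ws xs)|exact: (between_upper bs ws ys)].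
Qed.

(** Raising a common zero of [x] and [y] yields a neighbour of each one level up, again at distance
    2. A permutation of coordinates moves the ends of the next opened cycle onto these. *)
Lemma chain_step n i j N w x y p : chain n i j N w x y p -> i <= j -> j.+4 <= n ->
  exists w' x' y' p',
    chain n i j.+2 (N + 2 * minn 'C(n, j.+2) 'C(n, j.+3) - 2) w' x' y' p'.
Proof.
case=> cycM inM sizeM [ww wx wy] le_ij le_n.
have [|s [cyc bs sz]] := @level_pair_cycle n j.+2; first by lia.
(* With six vertices there is room for [b2], [b3], [b4] besides [t] and its two neighbours. *)
have sz5 : 5 < size s.
  rewrite sz; suff : 2 < minn 'C(n, j.+2) 'C(n, j.+3) by lia.
  by rewrite leq_min !bin_gt2 //; lia.
have sz0 : 0 < size s by exact: leq_trans sz5.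
have sz2 : 2 < size s by exact: leq_trans sz5.
have [_ [t ts wt_t]] := between_mem cyc bs sz0.
have [b [b' [p1 [perm cycB]]]] := ucycle_open3 cyc ts sz2.
have [bs1 bs2 adj_tb adj_tb' neq_b] := opened_facts bs perm cycB.
have wb : wt b = j.+2 by exact: (between_lower bs ts bs1 adj_tb wt_t).
have wb' : wt b' = j.+2 by exact: (between_lower bs ts bs2 adj_tb' wt_t).
have [szb _] := bs _ bs1; have [szb' _] := bs _ bs2.
have dbb := dist_common adj_tb adj_tb' neq_b.
have [adj_wx adj_wy neq_xy xw yw] : [/\ adj w x, adj w y, x != y,
    size x = n & size y = n].
  have := cycM; rewrite /ucycle /= rcons_path last_rcons.
  move=> /andP[/and3P[wx1 _ yw1] /and3P[_ x_p _]]; rewrite [adj w y]adj_sym; split=> //.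
  - by apply: contra x_p => /eqP->; rewrite mem_rcons mem_head.
  - by have [] := inM x; rewrite // !inE eqxx orbT.
  - by have [] := inM y; rewrite // !inE mem_rcons mem_head !orbT.
have dxy := dist_common adj_wx adj_wy neq_xy.
have [|x' [y' [xx' yy' wx' wy' d']]] := @common_raise x y (etrans xw (esym yw)).
  have [_ wx1 wy1 d1 s1] := zip_counts predT (etrans xw (esym yw)).
  rewrite -has_pred1 has_count.
  move: wx1 wy1 d1 s1; rewrite xw wx wy dxy.
  move: (count _ _) (count _ _) (count _ _) (count _ _) => c1 c2 c3 c4 *; lia.
have sx' : size x' = n by rewrite -(adj_size xx').
have sy' : size y' = n by rewrite -(adj_size yy').
rewrite wx in wx'; rewrite wy in wy'.
have [Is [pI act_b act_b']] := act_transitive szb szb' sx' sy' (etrans wb (esym wx'))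
  (etrans wb' (esym wy')) (etrans dbb (esym (etrans d' dxy))).
have inB v : v \in [:: t, b & rcons p1 b'] -> v \in s by rewrite (perm_mem perm).
have cycB' := ucycle_act pI (fun v vB => (bs v (inB v vB)).1) cycB.
have szB : size [:: t, b & rcons p1 b'] = size s by exact: perm_size.
case: p1 perm cycB inB cycB' szB => [|b2 [|b3 [|b4 q]]] perm cycB inB cycB' szB;
  try by move: sz5; rewrite -szB.
set f := act Is in act_b act_b' cycB'.
rewrite /= map_rcons in cycB'.
have inB' v : v \in map f [:: b, b2, b3, b4 & rcons q b'] ->
    size v = n /\ j.+2 <= wt v <= j.+3.
  case/mapP => u uB ->; have [|su wu] := bs u _; first by rewrite inB // in_cons uB orbT.
  by rewrite (act_size _ pI) (act_wt su pI).
have disj : ~~ has [in x :: rcons p y] (map f [:: b, b2, b3, b4 & rcons q b']).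
  apply/hasPn => v /inB'[_ wv]; apply/negP => vM.
  have [|_] := inM v _; first by rewrite in_cons; apply/orP; right.
  by move: wv; clear; lia.
have [|||cyc' perm'] := glue_opened adj_sym cycM cycB' _ _ _.
- by move: disj; rewrite /= map_rcons.
- by rewrite act_b.
- by rewrite act_b'.
have [s2 s3 s4] : [/\ b2 \in s, b3 \in s & b4 \in s].
  by split; apply: inB; rewrite !inE eqxx !orbT.
have /andP[] := cycB; rewrite /= => /and5P[_ a2 a3 a4 _] _.
have w2 := between_upper bs bs1 s2 a2 wb; have w3 := between_lower bs s2 s3 a3 w2.
have w4 := between_upper bs s3 s4 a4 w3.
have wf u v : wt u = v -> u \in s -> wt (f u) = v.
  by move=> <- /bs[su _]; exact: act_wt su pI.
exists (f b3), (f b2), (f b4), ((f b :: x :: rcons p y) ++ f b' :: rev (map f q)).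
split=> //; last by split; exact: wf.
- move=> v; rewrite (perm_mem perm') mem_cat => /orP[vM|vB].
    have [|sv wv] := inM v _; first by rewrite in_cons; apply/orP; right.
    by split=> //; move: wv; clear; lia.
  have [|sv wv] := inB' v _; first by rewrite /= map_rcons.
  by split=> //; move: wv le_ij; clear; lia.
rewrite (perm_size perm') size_cat /= !size_rcons size_map.
move: sizeM szB; rewrite /= !size_rcons sz; move: (2 * minn _ _) (size p) (size q).
by clear=> *; lia.
Qed.

Lemma level_pairs_cycle n i r : 0 < i -> (i + r.*2).+1 < n -> exists s,
  [/\ ucycle adj s, within n i (i + r.*2).+1 s
    & size s + r.*2 =
      \sum_(a < r.+1) 2 * minn 'C(n, i + a.*2) 'C(n, (i + a.*2).+1)].
Proof.
move=> i_gt0 lt_n; suff [N [w [x [y [p [[cyc inM sz _] eqN]]]]]] : exists N w x y p,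
    chain n i (i + r.*2) N w x y p /\ N + r.*2 =
    \sum_(a < r.+1) 2 * minn 'C(n, i + a.*2) 'C(n, (i + a.*2).+1).
  by exists (w :: x :: rcons p y); rewrite sz.
elim: r lt_n => [|r IH] lt_n.
  have [|w [x [y [p ch]]]] := @chain_start n i i_gt0; first by move: lt_n; clear; lia.
  by do 5 eexists; rewrite big_ord1 !addn0; split; first exact: ch.
have [|N [w [x [y [p [ch eqN]]]]]] := IH; first by move: lt_n; clear; lia.
have [||w' [x' [y' [p' ch']]]] := chain_step ch; [exact: leq_addr | |].
  by move: lt_n; clear; lia.
do 5 eexists; rewrite big_ord_recr /= -eqN doubleS !addnS; split; first exact: ch'.
have : 0 < minn 'C(n, (i + r.*2).+2) 'C(n, (i + r.*2).+3).
  by rewrite leq_min !bin_gt0; move: lt_n; clear; lia.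
by move: (minn _ _) => m; clear; lia.
Qed.

(** * Combs of 4-cycles *)

(* Q_(m+2) is a product of 4-cycles (the first two bits) with Q_m. The edges of the
   4-cycle over v are the pairs mixed c v -- const d v. *)
Definition mixed (c : bool) (v : seq bool) : seq bool := [:: c, ~~ c & v].
Definition const (d : bool) (v : seq bool) : seq bool := [:: d, d & v].

Definition fibre (c d : bool) (v : seq bool) : seq (seq bool) :=
  [:: mixed c v; const (~~ d) v; mixed (~~ c) v; const d v].

Lemma adj_mixed_const c d v : adj (mixed c v) (const d v).
Proof. by rewrite /mixed /const; case: c d => [] []; rewrite ?adj_cons ?adj_head // adj_sym
  /adj /= eqxx !dist_cons distxx. Qed.

Lemma adj_const_mixed c d v : adj (const d v) (mixed c v).
Proof. by rewrite adj_sym adj_mixed_const. Qed.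

Lemma adj_mixed c u v : adj (mixed c u) (mixed c v) = adj u v.
Proof. by rewrite !adj_cons. Qed.

Lemma adj_const d u v : adj (const d u) (const d v) = adj u v.
Proof. by rewrite !adj_cons. Qed.

Lemma mem_fibre c d v z : z \in fibre c d v -> exists a b, z = [:: a, b & v].
Proof. by rewrite !inE => /or4P[] /eqP ->; do 2 eexists. Qed.

Lemma fibre_uniq c d v : uniq (fibre c d v).
Proof. by case: c d => [] []; rewrite !cons_uniq !inE !eqseq_cons. Qed.

Lemma path_fibre c d u v : adj u v ->
  path adj (mixed c u) (rcons (fibre c d v) (const d u)).
Proof.
move=> uv; rewrite /= adj_mixed uv !adj_mixed_const adj_const_mixed.
by rewrite adj_const adj_sym uv.
Qed.

Lemma same_edge_mixed c d u c' d' u' :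
  same_edge (mixed c u) (const d u) (mixed c' u') (const d' u') ->
  [/\ c = c', d = d' & u = u'].
Proof.
rewrite /same_edge /mixed /const !eqseq_cons.
by case: c c' d d' => [] [] [] []; rewrite /= ?andbF ?orbF //= => /andP[/eqP-> _].
Qed.

(* Consecutive fibres are joined along edges at mixed false u; the edges at mixed true u
   remain free for the teeth of the comb. *)
Lemma backbone v l : path adj v l -> uniq (v :: l) ->
  exists s d, [/\ ucycle adj s, size s = 4 * size (v :: l),
    forall z, z \in s -> exists a b u, z = [:: a, b & u] /\ u \in v :: l,
    cedge s (mixed false (last v l)) (const d (last v l))
  & forall d' u, u \in v :: l -> cedge s (mixed true u) (const d' u)].
Proof.
elim/last_ind: l => [_ _|l w IH].
  exists (fibre false false v), false; split=> //.
  - by rewrite /ucycle fibre_uniq /= !adj_mixed_const !adj_const_mixed.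
  - by move=> z /mem_fibre[a [b ->]]; exists a, b, v; rewrite mem_head.
  - by rewrite /cedge /= !inE !eqxx !orbT.
  - move=> d' u; rewrite inE => /eqP ->.
    by case: d'; rewrite /cedge /= !inE !eqxx !orbT.
rewrite rcons_path -rcons_cons rcons_uniq => /andP[path_l adj_w] /andP[w_l u_l].
have [s [d [cyc sz mem edge edges]]] := IH path_l u_l.
have [||s' [cyc' perm' keep new]] := attach adj_sym cyc edge (path_fibre false d adj_w).
- exact: fibre_uniq.
- apply/hasPn => z /mem_fibre[a [b ->]] /=; apply: contra w_l.
  by case/mem => a' [b' [u [[_ _ ->]]]].
exists s', (~~ d); split=> //.
- by rewrite (perm_size perm') size_cat sz /= size_rcons; lia.
- move=> z; rewrite (perm_mem perm') mem_cat => /orP[/mem|/mem_fibre].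
    by case=> a [b [u [-> ul]]]; exists a, b, u; rewrite mem_rcons inE ul orbT.
  by case=> a [b ->]; exists a, b, w; rewrite mem_rcons mem_head.
- by rewrite last_rcons; apply: new; rewrite !inE eqxx orbT.
move=> d' u; rewrite mem_rcons inE => /orP[/eqP->|ul].
  have [->|->] : d' = d \/ d' = ~~ d by case: (d') (d) => [] []; auto.
    by apply: new; rewrite !inE !eqxx !orbT.
  by rewrite cedgeC; apply: new; rewrite !inE !eqxx !orbT.
apply: keep; first exact: edges.
by apply/negP => /same_edge_mixed[].
Qed.

(** The successor on a saturating cycle is injective and leads one level up. *)
Lemma lower_matching m i : i.*2.+1 <= m -> exists g : seq bool -> seq bool,
  {in lev m i &, injective g} /\
  {in lev m i, forall z, adj z (g z) /\ g z \in lev m i.+1}.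
Proof.
move=> le_m; have [s [cyc bs sz]] := saturating_cycle le_m.
have sat := saturated cyc bs sz; have /andP[_ us] := cyc.
exists (next s); split=> [|z z_lev]; first by move=> x y _ _; exact: next_inj.
have zs := sat _ z_lev; have az := next_mem_adj cyc zs; split=> //.
have nzs : next s z \in s by rewrite mem_next.
move: z_lev; rewrite !mem_lev => /andP[_ /eqP wz].
by rewrite (between_upper bs zs nzs az wz) (bs _ nzs).1 !eqxx.
Qed.

Lemma mem_lev_negb m i z : i <= m -> (map negb z \in lev m (m - i)) = (z \in lev m i).
Proof.
move=> le_i; rewrite !mem_lev size_map wt_negb; case: eqP => //= sz.
by have := wt_size z; rewrite sz => le_z; apply/eqP/eqP; lia.
Qed.

Lemma map_negbK : involutive (map negb).
Proof. exact/mapK/negbK. Qed.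

Lemma upper_matching m i : m <= i.*2.+1 -> exists g : seq bool -> seq bool,
  {in lev m i.+1 &, injective g} /\
  {in lev m i.+1, forall z, adj (g z) z /\ g z \in lev m i}.
Proof.
move=> le_m; have [lt_i|le_i] := ltnP i m; last first.
  have no z : z \in lev m i.+1 = false.
    by rewrite mem_lev; case: eqP => //= sz; have := wt_size z; rewrite sz; lia.
  by exists id; split=> [x y|z]; rewrite no.
have [|g [injg mem]] := @lower_matching m (m - i.+1); first by lia.
exists (fun z => map negb (g (map negb z))); split=> [x y x_lev y_lev|z z_lev].
  move/(inv_inj map_negbK)/injg => /(_ _ _)/(inv_inj map_negbK); apply;
    by rewrite mem_lev_negb.
have [|az gz] := mem (map negb z); first by rewrite mem_lev_negb.
rewrite -{2}(map_negbK z) adj_negb adj_sym az; split=> //.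
by rewrite -mem_lev_negb 1?ltnW // map_negbK -subnSK.
Qed.

Definition flip (d : bool) (v : seq bool) : seq bool := if d then map negb v else v.

Lemma flipK d : involutive (flip d).
Proof. by case: d => // v; exact: map_negbK. Qed.

Lemma adj_flip d u v : adj (flip d u) (flip d v) = adj u v.
Proof. by case: d => //; rewrite /flip adj_negb. Qed.

(* For m = 2h+1, the j-th level above (d = false) or below (d = true) the middle. *)
Definition outer (h : nat) (d : bool) (j : nat) : seq (seq bool) :=
  map (flip d) (lev h.*2.+1 (h.+1 + j)).

Lemma mem_outer h d j v : (v \in outer h d j) = (flip d v \in lev h.*2.+1 (h.+1 + j)).
Proof. by rewrite -{1}(flipK d v) mem_map //; exact: inv_inj (@flipK d). Qed.

Lemma outer_uniq h d j : uniq (outer h d j).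
Proof. by rewrite map_inj_uniq ?lev_uniq //; exact: inv_inj (@flipK d). Qed.

Lemma size_outer h d j : size (outer h d j) = 'C(h.*2.+1, h.+1 + j).
Proof. by rewrite size_map size_lev. Qed.

Lemma outer_facts h d j v : v \in outer h d j ->
  size v = h.*2.+1 /\ wt v + (if d then j else 0) = (if d then h else h.+1 + j).
Proof.
rewrite mem_outer mem_lev => /andP[/eqP + /eqP].
case: d => /=; last by rewrite addn0.
by rewrite size_map wt_negb => sv; have := wt_size v; rewrite sv; lia.
Qed.

Lemma outer_matching h d j : exists g : seq bool -> seq bool,
  {in outer h d j.+1 &, injective g} /\
  {in outer h d j.+1, forall z, adj (g z) z /\ g z \in outer h d j}.
Proof.
have [|g [injg mem]] := @upper_matching h.*2.+1 (h.+1 + j); first by lia.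
exists (fun z => flip d (g (flip d z))); split=> [x y|z]; rewrite !mem_outer !addnS.
  move=> x_lev y_lev; move/(inv_inj (@flipK d))/injg => /(_ x_lev y_lev).
  exact: inv_inj (@flipK d) _ _.
by move=> /mem[az gz]; rewrite -{2}(flipK d z) adj_flip flipK.
Qed.

(** Only edges at [const d] are used up. Those at [const (~~ d)] survive, so that the columns above
    and below can start from the same backbone. *)
Lemma column_attach h d j (c : bool) (p : seq bool -> seq (seq bool)) s :
  ucycle adj s ->
  {in outer h d j.+1, forall v a b, [:: a, b & v] \notin s} ->
  {in outer h d j, forall v, cedge s (mixed c v) (const d v)} ->
  (forall v z, z \in p v -> exists a b, z = [:: a, b & v]) ->
  (forall v, (p v != [::]) && uniq (p v)) ->
  (forall u v, adj u v -> path adj (mixed c u) (rcons (p v) (const d u))) ->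
  exists s', [/\ ucycle adj s',
    perm_eq s' (s ++ flatten (map p (outer h d j.+1))),
    forall v a b, v \in outer h d j.+1 ->
      (forall u, (a, b) \in steps (mixed c u) (rcons (p v) (const d u))) -> cedge s' a b
    & forall c' v, cedge s (mixed c' v) (const (~~ d) v) ->
        cedge s' (mixed c' v) (const (~~ d) v)].
Proof.
move=> cyc new_s edges mem_p up path_p.
have [g [injg mem_g]] := outer_matching h d j.
set r := outer h d j.+1 in injg mem_g new_s *.
have uP l : uniq l -> uniq (flatten (map p l)).
  elim: l => //= v l IH /andP[v_l /IH ul]; have /andP[_ upv] := up v.
  rewrite cat_uniq upv ul andbT /=; apply: contra v_l => /hasP[z /flatten_mapP[w wl]].
  by move=> /mem_p[a [b ->]] /mem_p[a' [b' [_ _ <-]]].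
have [|||||s' [cyc' perm' keep new]] := attach_many (r := r) (u := fun v => mixed c (g v))
    (v := fun v => const d (g v)) (p := p) adj_sym cyc (outer_uniq _ _ _).
- by move=> v /mem_g[_ gv]; exact: edges.
- by move=> v /mem_g[av _]; rewrite path_p //; have /andP[-> _] := up v.
- exact/uP/outer_uniq.
- by apply/hasPn => z /flatten_mapP[v vr /mem_p[a [b ->]]]; exact: new_s.
- by move=> v w vr wr /same_edge_mixed[_ _]; exact: injg.
exists s'; split=> // [v a b vr ab|c' v edge]; first exact: new vr _ _ (ab _).
by apply: keep edge _ => w _; apply/negP => /same_edge_mixed[_ /esym]; case: (d).
Qed.

(** A fibre over [v] attached by its edge between [mixed c v] and [const d v] keeps the edge between
    [mixed (~~ c) v] and [const d v]. The next level is attached there, so [c] alternates along the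
    column. *)
Lemma column h d r s : ucycle adj s ->
  (forall j v a b, v \in outer h d j.+1 -> [:: a, b & v] \notin s) ->
  {in outer h d 0, forall v, cedge s (mixed true v) (const d v)} ->
  exists s' c, [/\ ucycle adj s',
    size s' = size s + 4 * \sum_(j < r) 'C(h.*2.+1, h.+2 + j),
    forall z, z \in s' -> z \in s \/
      exists j a b v, [/\ j < r, z = [:: a, b & v] & v \in outer h d j.+1],
    {in outer h d r, forall v, cedge s' (mixed c v) (const d v)}
    & forall c' v, cedge s (mixed c' v) (const (~~ d) v) ->
        cedge s' (mixed c' v) (const (~~ d) v)].
Proof.
move=> cyc new_s edges; elim: r => [|r [s1 [c [cyc1 sz1 mem1 edges1 keep1]]]].
  by exists s, true; rewrite big_ord0 muln0 addn0; split=> // z; left.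
have [|v z|v|u v|s' [cyc' perm' new keep]] := column_attach (p := fibre c d) cyc1 _ edges1.
- move=> v vr a b; apply/negP => /mem1[|[j [a' [b' [w [lt_j [_ _ <-] vj]]]]]].
    exact/negP/(new_s _ _ _ _ vr).
  have [_] := outer_facts vr; have [_] := outer_facts vj.
  move: vr vj; rewrite !mem_outer !mem_lev => /andP[_ /eqP->] /andP[_ /eqP]; lia.
- exact: mem_fibre.
- by have := fibre_uniq c d v.
- by move=> uv; exact: path_fibre.
exists s', (~~ c); split=> //.
- rewrite (perm_size perm') size_cat sz1 big_ord_recr /= mulnDr addnA; congr (_ + _).
  rewrite addSnnS -(size_outer h d).
  by elim: (outer _ _ _) => //= v l ->; rewrite mulnS.
- move=> z; rewrite (perm_mem perm') mem_cat => /orP[/mem1[|]|]; first by left.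
    by case=> j [a [b [v [lt_j -> vj]]]]; right; exists j, a, b, v; split=> //; exact: leqW.
  case/flatten_mapP => v vr /mem_fibre[a [b ->]]; right.
  by exists r, a, b, v; rewrite ltnS leqnn.
- by move=> v vr; apply: (new v) => // u; rewrite !inE !eqxx !orbT.
by move=> c' v /keep1; exact: keep.
Qed.

(** On the outermost level [const (~~ d) v] already lies outside the permitted weights, so just two
    vertices are attached and [mixed (~~ c) v] is lost. *)
Lemma column_end h d r s c : ucycle adj s ->
  {in outer h d r.+1, forall v a b, [:: a, b & v] \notin s} ->
  {in outer h d r, forall v, cedge s (mixed c v) (const d v)} ->
  exists s', [/\ ucycle adj s',
    size s' = size s + 2 * 'C(h.*2.+1, h.+2 + r),
    forall z, z \in s' -> z \in s \/
      exists c v, (z = mixed c v \/ z = const d v) /\ v \in outer h d r.+1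
    & forall c' v, cedge s (mixed c' v) (const (~~ d) v) ->
        cedge s' (mixed c' v) (const (~~ d) v)].
Proof.
move=> cyc new_s edges; pose p v := [:: mixed c v; const d v].
have [v z|v|u v uv|s' [cyc' perm' _ keep]] := column_attach (p := p) cyc new_s edges.
- by rewrite !inE => /orP[] /eqP ->; do 2 eexists.
- by rewrite /p /mixed /const /= inE !eqseq_cons; case: (c) (d) => [] [].
- by rewrite /= adj_mixed uv adj_mixed_const adj_const adj_sym uv.
exists s'; split=> //.
- rewrite (perm_size perm') size_cat addSnnS -(size_outer h d); congr (_ + _).
  by elim: (outer _ _ _) => //= v l ->; rewrite mulnS.
move=> z; rewrite (perm_mem perm') mem_cat => /orP[|/flatten_mapP[v vr]]; first by left.
by rewrite !inE => /orP[] /eqP ->; right; exists c, v; split=> //; [left|right].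
Qed.

Lemma mem_middle_negb h z :
  (map negb z \in lev h.*2.+1 h.+1) = (z \in lev h.*2.+1 h).
Proof.
rewrite -(mem_lev_negb z (_ : h <= h.*2.+1)); last by lia.
by congr (_ \in lev _ _); lia.
Qed.

(** The parameters are [h = k - 1] and [r = c - 1]. The columns above leave the backbone at
    [const false], those below at [const true]. *)
Lemma comb_cycle h r : r <= h -> exists s,
  [/\ ucycle adj s, within h.*2.+3 (h - r) (h.+3 + r) s
    & size s = 8 * 'C(h.*2.+1, h) + 2 * (4 * \sum_(j < r) 'C(h.*2.+1, h.+2 + j) +
                                         2 * 'C(h.*2.+1, h.+2 + r))].
Proof.
move=> le_r; set m := h.*2.+1.
have [s0 [cyc0 b0 sz0]] := saturating_cycle (leqnn m : h.*2.+1 <= m).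
(* Both middle levels have the same size; saturation of the lower one by the complemented cycle
   gives saturation of the upper one by the cycle itself. *)
have outer0 d v : v \in outer h d 0 -> v \in s0.
  rewrite mem_outer addn0; case: d => /= v_lev.
    by apply: (saturated cyc0 b0 sz0); rewrite -mem_middle_negb.
  have negK : between m h (map (map negb) s0).
    apply: between_negb; first by rewrite /m; lia.
    by rewrite (_ : m - h.+1 = h) // /m; lia.
  have cycN : ucycle adj (map (map negb) s0).
    by apply: ucycle_map cyc0; [exact/inj_map/negb_inj | exact: adj_negb].
  rewrite -(mem_map (inv_inj map_negbK)); apply: (saturated cycN negK).
    by rewrite size_map.
  by rewrite -mem_middle_negb map_negbK.
have [cyc0' u0] := andP cyc0.
have range0 v : v \in s0 -> h <= wt v <= h.+1 by case/b0.
case: s0 => [|v l] in cyc0 b0 sz0 outer0 cyc0' u0 range0.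
  have : 0 < 'C(m, h) by rewrite bin_gt0 /m; lia.
  by move: sz0; rewrite -/m; case: 'C(m, h).
have path_l : path adj v l by move: cyc0'; rewrite /= rcons_path => /andP[].
have [s1 [d [cyc1 sz1 mem1 _ edges1]]] := backbone path_l u0.
have new1 d' j w a b : w \in outer h d' j.+1 -> [:: a, b & w] \notin s1.
  move=> wj; apply/negP => /mem1[_ [_ [_ [[_ _ <-] /range0]]]].
  have [_] := outer_facts wj; case: (d') => /=; lia.
have [|w w0|s2 [c2 [cyc2 sz2 mem2 edges2 keep2]]] := @column h false r s1 cyc1.
- by move=> j w a b; exact: new1.
- by apply: edges1; exact: outer0 w0.
have level_eq d' i j w : w \in outer h d' i -> w \in outer h d' j -> i = j.
  by rewrite !mem_outer !mem_lev => /andP[_ /eqP->] /andP[_ /eqP]; lia.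
have [|s3 [cyc3 sz3 mem3 keep3]] := column_end cyc2 _ edges2.
  move=> w wr a b; apply/negP => /mem2[|[j [a' [b' [v' [lt_j [_ _ <-] wj]]]]]].
    exact/negP/(new1 _ _ _ _ _ wr).
  by have := level_eq _ _ _ _ wr wj; lia.
have mem_false z : z \in s3 -> z \in s1 \/ exists a b j w, [/\ z = [:: a, b & w],
    w \in outer h false j.+1 & h <= wt z <= h.+3 + r].
  case/mem3 => [/mem2[|]|]; first by left.
    case=> j [a [b [w [lt_j -> wj]]]]; right; exists a, b, j, w; split=> //.
    by have [_] := outer_facts wj; rewrite /= !wt_cons; case: (a) (b) => [] [] /=; lia.
  case=> c [w [eq_z wr]]; have [_] := outer_facts wr; rewrite /= => wt_w.
  by case: eq_z => ->; right; do 4 eexists; (split; [reflexivity | exact: wr |]);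
    rewrite !wt_cons; [case: (c) => /=; lia | move=> /=; lia].
have new3 j w a b : w \in outer h true j.+1 -> [:: a, b & w] \notin s3.
  move=> wj; apply/negP => /mem_false[|[_ [_ [j' [_ [[_ _ <-] wj' _]]]]]].
    exact/negP/(new1 _ _ _ _ _ wj).
  by have [_] := outer_facts wj; have [_] := outer_facts wj' => /=; lia.
have [|w w0|s4 [c4 [cyc4 sz4 mem4 edges4 _]]] := @column h true r s3 cyc3.
- by move=> j w a b; exact: new3.
- by apply/keep3/keep2/edges1; exact: outer0 w0.
have [|s5 [cyc5 sz5 mem5 _]] := column_end cyc4 _ edges4.
  move=> w wr a b; apply/negP => /mem4[|[j [a' [b' [v' [lt_j [_ _ <-] wj]]]]]].
    exact/negP/(new3 _ _ _ _ wr).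
  by have := level_eq _ _ _ _ wr wj; lia.
exists s5; split=> //; last first.
  rewrite sz5 sz4 sz3 sz2 sz1 sz0 -/m.
  by move: (\sum_(j < r) _) ('C(_, _)) ('C(_, h.+2 + r)); clear=> *; lia.
have bound1 z : z \in s1 -> size z = m.+2 /\ h <= wt z <= h.+3.
  case/mem1 => a [b [w [-> ws]]]; have [sw ww] := b0 _ ws.
  by rewrite /= sw !wt_cons; split=> //; case: (a) (b) => [] [] /=; lia.
move=> z /mem5[/mem4[|]|].
- case/mem_false => [/bound1[sz wz]|[a [b [j [w [-> wj wz]]]]]].
    by case/andP: wz => l1 l2; rewrite sz (leq_trans (leq_subr _ _) l1) (leq_trans l2) // leq_addr.
  by have [sw _] := outer_facts wj; case/andP: wz => l1 l2;
    rewrite /= sw l2 (leq_trans (leq_subr _ _) l1).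
- case=> j [a [b [w [lt_j -> wj]]]]; have [sw] := outer_facts wj.
  rewrite /= sw !wt_cons; split=> //.
  by case: (a) (b) => [] [] /=; lia.
case=> c [w [eq_z wr]]; have [sw wt_w] := outer_facts wr; rewrite /= in wt_w.
case: eq_z => ->; rewrite /= sw !wt_cons; split=> //.
  by case: (c) => /=; lia.
by move=> /=; lia.
Qed.

(** * Counting *)

Definition total (k c : nat) : nat := \sum_(a < c.+1.*2) 'C(k.*2.+1, k - c + a).

Lemma geq_bin n i : n <= i.*2.+1 -> 'C(n, i.+1) <= 'C(n, i).
Proof.
move=> le_n; have := mul_bin_left n i.
by move: ('C(n, i)) ('C(n, i.+1)) => a b; nia.
Qed.

Lemma leq_bin_mid k i j : i <= j <= k -> 'C(k.*2.+1, i) <= 'C(k.*2.+1, j).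
Proof.
case/andP; elim: j => [|j IH]; first by rewrite leqn0 => /eqP ->.
rewrite leq_eqVlt => /orP[/eqP-> //|le_i] le_j.
by apply: leq_trans (IH le_i (ltnW le_j)) (leq_bin _); lia.
Qed.

Lemma geq_bin_mid k i j : k < i <= j -> 'C(k.*2.+1, j) <= 'C(k.*2.+1, i).
Proof.
case/andP=> lt_k; elim: j => [|j IH]; first by rewrite leqn0 => /eqP ->.
rewrite leq_eqVlt => /orP[/eqP-> //|le_i].
by apply: leq_trans (geq_bin _) (IH le_i); lia.
Qed.

Lemma total_upper k c : c <= k ->
  total k c = 2 * \sum_(a < c.+1) 'C(k.*2.+1, k.+1 + a).
Proof.
move=> le_c; rewrite /total -[c.+1.*2]addnn big_split_ord /= mulSn mul1n; congr (_ + _).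
  rewrite (reindex_inj rev_ord_inj) /=; apply: eq_bigr => i _.
  have lt_i := ltn_ord i; rewrite -bin_sub; last by lia.
  by congr 'C(_, _); lia.
by apply: eq_bigr => i _; congr 'C(_, _); lia.
Qed.

Lemma sum_pairs (f : nat -> nat) m :
  \sum_(a < m.*2) f a = \sum_(a < m) (f a.*2 + f a.*2.+1).
Proof.
by elim: m => [|m IH]; rewrite ?big_ord0 // doubleS !big_ord_recr /= IH addnA.
Qed.

(** Two applications of Pascal's rule write a level of Q_(2h+3) as such a summand. The last bracket
    counts what the comb misses on one side. *)
Lemma sum_second_difference (f : nat -> nat) r : f 0 = f 1 ->
  \sum_(j < r.+2) (f j.+2 + 2 * f j.+1 + f j) =
  4 * f 0 + 4 * (\sum_(j < r) f j.+2) + 2 * f r.+2 + (f r.+2 + f r.+3).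
Proof.
move=> f01; elim: r => [|r IH]; first by rewrite !big_ord_recr !big_ord0 /= -f01; lia.
by rewrite big_ord_recr IH [\sum_(j < r.+1) _]big_ord_recr /=; lia.
Qed.

(** By monotonicity beyond the middle, the number of missed vertices is at most the size of the
    outermost level, the smallest of the [2 * r.+2] levels. *)
Lemma comb_count h r : r <= h ->
  let f a := 'C(h.*2.+1, h + a) in
  let N := 8 * 'C(h.*2.+1, h) + 2 * (4 * \sum_(j < r) 'C(h.*2.+1, h.+2 + j) +
                                         2 * 'C(h.*2.+1, h.+2 + r)) in
  total h.+1 r.+1 <= N + 2 * (f r.+2 + f r.+3) /\
  2 * r.+2 * (2 * (f r.+2 + f r.+3)) <= total h.+1 r.+1.
Proof.
move=> le_r f N; rewrite total_upper ?ltnS //.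
have binE a : 'C(h.+1.*2.+1, h.+2 + a) = f a.+2 + 2 * f a.+1 + f a.
  by rewrite doubleS /f !addnS !addSn !binS; lia.
have f01 : f 0 = f 1.
  by rewrite /f addn0 addn1 -[RHS]bin_sub; [congr 'C(_, _); lia | lia].
split.
  rewrite (eq_bigr (fun a : 'I__ => f a.+2 + 2 * f a.+1 + f a)) => [|a _]; last exact: binE.
  rewrite (sum_second_difference _ f01) /N.
  have -> : \sum_(j < r) 'C(h.*2.+1, h.+2 + j) = \sum_(j < r) f j.+2.
    by apply: eq_bigr => j _; rewrite /f !addnS.
  have -> : 'C(h.*2.+1, h.+2 + r) = f r.+2 by rewrite /f !addnS.
  have -> : 'C(h.*2.+1, h) = f 0 by rewrite /f addn0.
  by clearbody f; clear; lia.
have le_E : 2 * (f r.+2 + f r.+3) <= 'C(h.+1.*2.+1, h.+2 + r.+1).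
  have l1 : f r.+2 <= f r.+1 by rewrite /f addnS geq_bin //; lia.
  have l2 : f r.+3 <= f r.+2 by rewrite /f addnS geq_bin //; lia.
  by rewrite binE; move: l1 l2; clearbody f; clear; lia.
rewrite -mulnA leq_mul2l /= (leq_trans (leq_mul (leqnn _) le_E)) //.
rewrite -[X in X * _](card_ord r.+2) -sum_nat_const; apply: leq_sum => a _.
by apply: geq_bin_mid; have := ltn_ord a; lia.
Qed.

(** Consecutive binomials u, v satisfy (2k+1-m)(v-u) = 2(k-m)v, and 2k+1-m is at least k+2 once m <
    k; for m = k they agree. This is the source of the factor k+2, which leaves slack against
    k-c. *)
Lemma bin_gap k m : m <= k ->
  (k + 2) * 'C(k.*2.+1, m.+1) <= (k + 2) * 'C(k.*2.+1, m) + 2 * (k - m) * 'C(k.*2.+1, k).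
Proof.
rewrite leq_eqVlt => /orP[/eqP->|lt_m].
  by rewrite subnn muln0 mul0n addn0 leq_mul2l geq_bin ?orbT.
have le_v : 'C(k.*2.+1, m.+1) <= 'C(k.*2.+1, k) by apply: leq_bin_mid; rewrite lt_m leqnn.
have le_uv : 'C(k.*2.+1, m) <= 'C(k.*2.+1, m.+1) by apply: leq_bin; lia.
have := mul_bin_left k.*2.+1 m.
move: ('C(_, m)) ('C(_, m.+1)) ('C(_, k)) le_v le_uv => u v b le_v le_uv eq_uv.
have eq_d : (k.*2.+1 - m) * (v - u) = 2 * (k - m) * v by nia.
rewrite -leq_subLR -mulnBr (@leq_trans ((k.*2.+1 - m) * (v - u))) //.
  by rewrite leq_mul2r; lia.
by rewrite eq_d leq_mul2l le_v orbT.
Qed.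

(** The two binomials exceed twice their minimum by their absolute difference, and with truncated
    subtraction [(k - m) + (m - k)] is the distance of [k] and [m]. Reflection reduces levels above
    the middle to [bin_gap]. *)
Lemma bin_gap_abs k m : m <= k.*2 ->
  (k + 2) * ('C(k.*2.+1, m) + 'C(k.*2.+1, m.+1)) <=
  (k + 2) * (2 * minn 'C(k.*2.+1, m) 'C(k.*2.+1, m.+1)) +
  2 * ((k - m) + (m - k)) * 'C(k.*2.+1, k).
Proof.
move=> le_m; have [le_mk|lt_km] := leqP m k.
  have := bin_gap le_mk; rewrite -[m - k]/(m - k) (eqP le_mk) addn0.
  have [le|lt] := leqP m.*2.+1 k.*2.+1; last by lia.
  by rewrite (minn_idPl (leq_bin le)); nia.
have le' : k.*2 - m <= k by lia.
have := bin_gap le'; rewrite -(bin_sub (_ : m <= k.*2.+1)); last by lia.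
rewrite -[in 'C(_, m.+1)](bin_sub (_ : m.+1 <= k.*2.+1)) //.
rewrite (_ : k.*2.+1 - m = (k.*2 - m).+1); last by lia.
rewrite (_ : k.*2.+1 - m.+1 = k.*2 - m); last by lia.
have le2 : 'C(k.*2.+1, k.*2 - m) <= 'C(k.*2.+1, (k.*2 - m).+1) by apply: leq_bin; lia.
rewrite (minn_idPr le2) (_ : k - m = 0); last by lia.
rewrite (_ : k - (k.*2 - m) = m - k); last by lia.
by rewrite add0n; nia.
Qed.

(** The origin of (c+1)^2 in [eps]. From c to c+2 the sum gains two extreme terms c+2, and 4(c+2) =
    (c+3)^2 - (c+1)^2. *)
Lemma sum_gap c : 2 * \sum_(a < c.+1) ((c - a.*2) + (a.*2 - c)) <= c.+1 ^ 2.
Proof.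
have [m] := ubnP c; elim: m c => // m IH [|[|c]] lt_m.
- by rewrite big_ord1.
- by rewrite !big_ord_recr big_ord0.
have le_IH := IH c (ltnW lt_m); rewrite big_ord_recl big_ord_recr /=.
rewrite (eq_bigr (fun a : 'I_c.+1 => (c - a.*2) + (a.*2 - c))) => [|a _].
  by move: (\sum_(_ < _) _) le_IH => S; rewrite /bump /=; clear; nia.
by rewrite /bump /=; lia.
Qed.

Lemma pairs_count k c : c < k ->
  let b := 'C(k.*2.+1, k) in
  let M := \sum_(a < c.+1)
    2 * minn 'C(k.*2.+1, k - c + a.*2) 'C(k.*2.+1, (k - c + a.*2).+1) in
  (k + 2) * total k c <= (k + 2) * M + c.+1 ^ 2 * b.
Proof.
move=> lt_c; cbv zeta; set b := 'C(k.*2.+1, k).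
rewrite /total (sum_pairs (fun a => 'C(k.*2.+1, k - c + a))) !big_distrr /=.
apply: (@leq_trans (\sum_(a < c.+1) ((k + 2) *
    (2 * minn 'C(k.*2.+1, k - c + a.*2) 'C(k.*2.+1, (k - c + a.*2).+1)) +
    2 * ((c - a.*2) + (a.*2 - c)) * b))).
  apply: leq_sum => a _; have lt_a := ltn_ord a.
  rewrite (addnS (k - c)); apply: leq_trans (bin_gap_abs _) _; first by lia.
  by rewrite leq_add2l leq_mul2r; apply/orP; right; lia.
rewrite big_split leq_add2l /= -big_distrl leq_mul2r /= -big_distrr /=.
by rewrite sum_gap orbT.
Qed.

(** The gaps bounded in [bin_gap] add up to 2(1 + ... + j) = j(j+1). *)
Lemma bin_near_mid k j : j <= k ->
  (k + 2) * 'C(k.*2.+1, k) <=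
  (k + 2) * 'C(k.*2.+1, k - j) + j * j.+1 * 'C(k.*2.+1, k).
Proof.
elim: j => [_|j IH lt_j]; first by rewrite subn0 leq_addr.
apply: leq_trans (IH (ltnW lt_j)) _.
have := @bin_gap k (k - j.+1) (leq_subr _ _).
rewrite (_ : (k - j.+1).+1 = k - j) 1?subnSK // subKn //.
by move: ('C(_, k - j)) ('C(_, k - j.+1)) ('C(_, k)) => u v b; nia.
Qed.

Lemma sum_pronic c : 3 * \sum_(j < c.+1) j * j.+1 = c * c.+1 * c.+2.
Proof.
elim: c => [|c IH]; first by rewrite big_ord1.
by rewrite big_ord_recr /= mulnDr IH; nia.
Qed.

(** Losses are measured in the central binomial [b], but [eps] is a fraction of the total; this
    compares the two, up to a relative error of c(c+2)/(3(k+2)). *)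
Lemma total_lower k c : c <= k -> let b := 'C(k.*2.+1, k) in
  6 * c.+1 * (k + 2) * b <= 3 * (k + 2) * total k c + 2 * (c * c.+1 * c.+2) * b.
Proof.
move=> le_c; cbv zeta; set b := 'C(k.*2.+1, k); rewrite total_upper //.
have : \sum_(j < c.+1) (k + 2) * b <=
    \sum_(j < c.+1) ((k + 2) * 'C(k.*2.+1, k.+1 + j) + j * j.+1 * b).
  apply: leq_sum => j _; have lt_j := ltn_ord j.
  rewrite -[in 'C(_, k.+1 + j)]bin_sub; last by lia.
  rewrite (_ : k.*2.+1 - (k.+1 + j) = k - j); last by lia.
  by apply: bin_near_mid; lia.
rewrite sum_nat_const card_ord big_split -!big_distrr -big_distrl /= -sum_pronic.
set S := \sum_(i < _) 'C(_, k.+1 + i); set P := \sum_(i < _) i * _.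
by clearbody b S P; clear; nia.
Qed.

(** The left side is binomial(2k+1, 2). The bound makes the vertices lost at the joints
    negligible. *)
Lemma central_bin_large k : 1 < k -> k * k.*2.+1 <= 'C(k.*2.+1, k).
Proof.
move=> k_gt1; apply: leq_trans (leq_bin_mid (_ : 2 <= k <= k)); last by rewrite k_gt1 leqnn.
by rewrite bin2 /=; lia.
Qed.

Lemma middle_levels_cycle k : 0 < k -> exists s,
  [/\ ucycle adj s, within k.*2.+1 (k - 0) (k + 1 + 0) s, 2 < size s
    & total k 0 <= size s].
Proof.
move=> k_gt0; have [s [cyc bs sz]] := saturating_cycle (leqnn k.*2.+1).
exists s; split=> //; first by rewrite subn0 addn0 addn1.
- by rewrite sz; have := @bin_gt1 k.*2.+1 k; lia.
rewrite total_upper // big_ord1 sz leq_mul2l /=.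
by rewrite addn0 geq_bin.
Qed.

Lemma wide_cycle k c : 0 < c <= k -> exists s,
  [/\ ucycle adj s, within k.*2.+1 (k - c) (k + 1 + c) s, 2 < size s
    & 2 * c.+1 * total k c <= 2 * c.+1 * size s + total k c].
Proof.
case: c => // r; case: k => // h /=; rewrite ltnS => le_r.
have [s [cyc ws sz]] := comb_cycle le_r; exists s.
have [le1 le2] := comb_count le_r.
have -> : h.+1 + 1 + r.+1 = h.+3 + r by rewrite addn1 addnS.
split=> //.
  by rewrite sz; have : 0 < 'C(h.*2.+1, h) by [rewrite bin_gt0; lia]; lia.
rewrite -sz in le1; move: le1 le2.
move: (total _ _) (size s) ('C(_, _) + _) => T S E le1 le2; clear -le1 le2; nia.
Qed.

Lemma narrow_cycle k c : 0 < c < k -> exists s,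
  [/\ ucycle adj s, within k.*2.+1 (k - c) (k + 1 + c) s, 2 < size s
    & (k + 2) * total k c <= (k + 2) * (size s + 2 * c) + c.+1 ^ 2 * 'C(k.*2.+1, k)].
Proof.
case/andP=> c_gt0 lt_c; have le := pairs_count lt_c.
have [||s [cyc ws sz]] := @level_pairs_cycle k.*2.+1 (k - c) c; [lia | lia |].
exists s; split=> //.
- by rewrite (_ : k + 1 + c = (k - c + c.*2).+1) //; lia.
- suff : \sum_(a < c.+1) 4 <= size s + c.*2 by rewrite sum_nat_const card_ord; lia.
  rewrite sz; apply: leq_sum => a _; have lt_a := ltn_ord a.
  by rewrite (leq_mul2l 2 2) leq_min !bin_gt1 //; lia.
by rewrite mul2n sz.
Qed.

(** * Transfer to tuples and the sizes of the levels *)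

Lemma cube_adjE n (x y : bitstring n) : cube_adj x y = adj x y.
Proof.
rewrite /cube_adj /adj !size_tuple eqxx /=; congr (_ == _).
rewrite cardE /enum_mem size_filter /dist.
rewrite -[in RHS](map_tnth_enum x) -[in RHS](map_tnth_enum y) zip_map count_map enumT.
exact: eq_count.
Qed.

Lemma cube_cycle_of_seq n i j (s : seq (seq bool)) :
  ucycle adj s -> within n i j s -> 2 < size s ->
  exists2 t : seq (bitstring n), is_cube_cycle i j t & size t = size s.
Proof.
move=> /andP[cyc us] ws sz; pose f z : bitstring n := insubd (nseq_tuple n false) z.
have fK z : z \in s -> val (f z) = z by case/ws => /eqP sz_z _; rewrite val_insubd sz_z.
have sK : map val (map f s) = s by rewrite -map_comp -[RHS]map_id; exact/eq_in_map.
exists (map f s); last by rewrite size_map.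
split; first by rewrite size_map.
  rewrite /ucycle -(map_inj_uniq val_inj) sK us andbT.
  rewrite -{1}sK cycle_map in cyc; move: cyc; apply: sub_cycle => x y /=.
  by rewrite cube_adjE.
move=> _ /mapP[z zs ->]; rewrite inE /weight fK //; by have [_] := ws z zs.
Qed.

Lemma card_level n a : #|[set x : bitstring n | weight x == a]| = 'C(n, a).
Proof.
rewrite cardE -size_lev -(size_map val); apply/perm_size/uniq_perm.
- by rewrite map_inj_uniq ?enum_uniq //; exact: val_inj.
- exact: lev_uniq.
move=> z; apply/mapP/idP => [[x + ->]|].
  by rewrite mem_enum inE mem_lev size_tuple eqxx.
rewrite mem_lev => /andP[sz wz]; exists (Tuple sz) => //.
by rewrite mem_enum inE.
Qed.

Lemma card_levels n i d : #|levels n i (i + d)| = \sum_(a < d.+1) 'C(n, i + a).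
Proof.
elim: d => [|d IH].
  rewrite big_ord1 addn0 -card_level; apply: eq_card => x; rewrite !inE.
  by rewrite andbC -eqn_leq.
rewrite big_ord_recr /= -IH -card_level.
have -> : levels n i (i + d.+1) =
    levels n i (i + d) :|: [set x : bitstring n | weight x == i + d.+1].
  apply/setP => x; rewrite !inE addnS [weight x <= _]leq_eqVlt ltnS andb_orr orbC.
  congr (_ || _); apply/andP/idP => [[] //|/eqP->]; by rewrite eqxx -addnS leq_addr.
rewrite cardsU; set I := _ :&: _.
have -> : I = finset.set0.
  apply/setP => x; rewrite !inE; apply/negP => /andP[/andP[_ le_x] /eqP eq_x].
  by move: le_x; rewrite eq_x; lia.
by rewrite cards0 subn0.
Qed.

Lemma card_central_levels k c : c <= k ->
  #|levels (2 * k + 1) (k - c) (k + 1 + c)| = total k c.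
Proof.
move=> le_c; rewrite (_ : k + 1 + c = k - c + c.*2.+1); last by lia.
by rewrite card_levels mul2n addn1.
Qed.

(** * Real estimates and the limit *)

Local Open Scope classical_set_scope.
Local Open Scope ring_scope.

Lemma expR_ge_quadratic (R : realType) (x : R) :
  0 <= x -> 1 + x + x ^+ 2 / 2 <= expR x.
Proof.
move=> x_ge0; have := @nondecreasing_cvgn_le R (series (exp_coeff x)) _
  (is_cvg_series_exp_coeff x) 3%N.
rewrite /series /= !big_nat_recr //= big_nil /exp_coeff /= add0r expr0 expr1 !divr1.
apply; apply/nondecreasing_seqP => n; rewrite big_nat_recr //= lerDl.
by rewrite divr_ge0 ?exprn_ge0.
Qed.

(** To be read with s = c+1, K = k+2, d = k-c, [b] the central binomial, [T] the total, [N] the size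
    of the cycle and [E] the exponential of s^2/d. *)
Lemma narrow_estimate (R : realFieldType) (s K d b T N E : R) :
  1 <= s -> 0 < d -> K = d + s + 1 -> s ^+ 2 / d <= 1 -> d * K <= b ->
  1 + s ^+ 2 / d + (s ^+ 2 / d) ^+ 2 / 2 <= E ->
  K * T <= K * (N + 2 * (s - 1)) + s ^+ 2 * b ->
  6 * s * K * b <= 3 * K * T + 2 * ((s - 1) * s * (s + 1)) * b ->
  (1 - (2 * s)^-1 * (E - 1)) * T <= N.
Proof.
move=> s1 d0 defK; set x := s ^+ 2 / d => x1 le_b leE h1 h2.
have K0 : 0 < K by rewrite defK; lra.
have s0 : 0 < s by lra.
have b0 : 0 < b by apply: lt_le_trans le_b; rewrite mulr_gt0.
have x0 : 0 < x by rewrite divr_gt0 ?exprn_gt0.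
pose y := s ^+ 2 / K.
have xd : x * d = s ^+ 2 by rewrite /x divfK // gt_eqF.
have yK : y * K = s ^+ 2 by rewrite /y divfK // gt_eqF.
have y0 : 0 < y by rewrite divr_gt0 ?exprn_gt0.
have hA : T - 2 * (s - 1) - y * b <= N.
  by rewrite -(ler_pM2l K0) -subr_ge0; move: h1; rewrite -yK -subr_ge0; congr (_ <= _); ring.
(* The slack x-y equals s^2 (s+1)/(dK), so [dK <= b] makes it worth at least s^2 (s+1) vertices,
   enough for the joints. *)
have hC : 2 * (s - 1) <= (x - y) * b.
  have eq_xy : (x - y) * (d * K) = s ^+ 2 * (s + 1).
    by rewrite mulrBl mulrA xd mulrCA [y * K]yK defK; ring.
  have xy0 : 0 <= x - y.
    rewrite -(pmulr_lge0 _ (mulr_gt0 d0 K0)) eq_xy mulr_ge0 ?exprn_ge0 //; lra.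
  apply: (@le_trans _ _ ((x - y) * (d * K))); last by rewrite ler_wpM2l.
  by rewrite eq_xy; nra.
have hxy : y <= x by rewrite -subr_ge0 -(pmulr_lge0 _ b0); apply: le_trans hC; lra.
have hB : 2 * s * b * (1 - x / 3) <= T.
  apply: (@le_trans _ _ (2 * s * b * (1 - y / 3))).
    by rewrite ler_wpM2l ?mulr_ge0 ?ler_wpM2r ?lerD2l ?lerN2 ?invr_ge0 //; lra.
  rewrite -(ler_pM2l K0) -subr_ge0.
  have e1 : s * K * b * y = s * s ^+ 2 * b by rewrite -yK; ring.
  suff : 0 <= 3 * (K * T - K * (2 * s * b * (1 - y / 3))) by rewrite pmulr_rge0.
  have -> : 3 * (K * T - K * (2 * s * b * (1 - y / 3))) =
            3 * K * T - 6 * s * K * b + 2 * (s * K * b * y) by field.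
  have sb0 : 0 <= s * b by rewrite mulr_ge0 ?ltW.
  have e2 : 2 * ((s - 1) * s * (s + 1)) * b = 2 * (s * s ^+ 2 * b) - 2 * (s * b) by ring.
  rewrite e1; move: h2 sb0; rewrite e2.
  by move: (s * s ^+ 2 * b) (s * b) (3 * K * T) (6 * s * K * b) => *; lra.
(* The linear bound E - 1 >= x would lose against the factor 1 - x/3. With the quadratic term, (1 +
   x/2)(1 - x/3) = 1 + x(1-x)/6 is at least 1 for x <= 1. *)
have hD : x * b <= (2 * s)^-1 * (E - 1) * T.
  have s20 : 0 < 2 * s by lra.
  have -> : (2 * s)^-1 * (E - 1) * T = (2 * s)^-1 * ((E - 1) * T) by rewrite mulrA.
  rewrite ler_pdivlMl //.
  apply: (@le_trans _ _ ((x + x ^+ 2 / 2) * (2 * s * b * (1 - x / 3)))); last first.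
    apply: ler_pM; rewrite ?hB //; [| | lra].
      by rewrite addr_ge0 ?divr_ge0 ?exprn_ge0 ?ltW.
    by rewrite !mulr_ge0 ?ltW //; lra.
  have -> : (x + x ^+ 2 / 2) * (2 * s * b * (1 - x / 3)) =
            2 * s * (x * b) * ((1 + x / 2) * (1 - x / 3)) by field.
  have x1x : 0 <= x * (1 - x) by apply: mulr_ge0; rewrite ?subr_ge0 // ltW.
  apply: ler_peMr; first by apply: mulr_ge0; [lra | apply: mulr_ge0; exact: ltW].
  have -> : (1 + x / 2) * (1 - x / 3) = 1 + x * (1 - x) / 6 by field.
  by rewrite lerDl divr_ge0.
rewrite mulrBl mul1r; lra.
Qed.

Lemma expR_ge1 (R : realType) (x : R) : 0 <= x -> 1 <= expR x.
Proof. by rewrite -[X in _ -> X <= _](@expR0 R) ler_expR. Qed.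

Lemma eps_bounds (R : realType) (k c : nat) :
  0 <= eps R k c <= ((2 * c.+1)%N%:R)^-1.
Proof.
rewrite /eps; set x := expR _ - 1; have x0 : 0 <= x.
  by rewrite subr_ge0 expR_ge1 // divr_ge0 ?exprn_ge0.
have u0 : 0 <= ((2 * c.+1)%N%:R : R)^-1 by rewrite invr_ge0.
set m : R := if _ then _ else _; have /andP[m0 m1] : 0 <= m <= 1.
  by rewrite /m; case: eqP => _; rewrite ?ler01 ?lexx // le_min ler01 x0 ge_min lexx.
by rewrite mulr_ge0 //= ler_piMr.
Qed.

(** For x <= 1/2, exp(x) <= 1/(1-x) <= 1 + 2x, and the factor 2 is cancelled by 1/(2(c+1)) <=
    1/2. *)
Lemma eps_small (R : realType) (k c : nat) (z : R) : (c < k)%N ->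
  (c.+1)%:R ^+ 2 / (k - c)%N%:R <= z -> z <= 1 / 2 -> eps R k c <= z.
Proof.
move=> lt_c; set x := _ / _ => le_z z_half.
have x0 : 0 <= x by rewrite divr_ge0 ?exprn_ge0.
have expx : expR x - 1 <= 2 * x.
  have e_gt0 := expR_gt0 x.
  have e_le : expR x * (1 - x) <= 1.
    rewrite -[X in _ <= X](expRxMexpNx_1 x).
    by rewrite (ler_wpM2l (ltW e_gt0)) // expR_ge1Dx.
  have x_half : x <= 1 / 2 by exact: le_trans z_half.
  have d_gt0 : 0 < 1 - x by lra.
  rewrite lerBlDr -(ler_pM2r d_gt0) (le_trans e_le) // -subr_ge0.
  have -> : (2 * x + 1) * (1 - x) - 1 = x * (1 - 2 * x) by ring.
  by rewrite mulr_ge0 //; lra.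
rewrite /eps ltn_eqF //; apply: (@le_trans _ _ (2^-1 * (2 * x))); last first.
  by rewrite mulrA mulVf ?mul1r.
apply: ler_pM.
- by rewrite invr_ge0.
- by rewrite le_min ler01 subr_ge0 expR_ge1.
- by rewrite lef_pV2 ?posrE ?ltr0n // ler_nat leq_pmulr.
by rewrite ge_min expx orbT.
Qed.

Lemma central_cycle (R : realType) (k c : nat) : (0 < k)%N -> (c <= k)%N ->
  exists t : seq (bitstring (2 * k + 1)),
    is_cube_cycle (k - c) (k + 1 + c) t /\
    (1 - eps R k c) * (total k c)%:R <= (size t)%:R.
Proof.
move=> k_gt0 le_c; have eq_n : k.*2.+1 = (2 * k + 1)%N by rewrite mul2n addn1.
have [eps_ge0 eps_le] := andP (eps_bounds R k c).
suff [s [cyc ws sz le_s]] : exists s, [/\ ucycle adj s,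
    within k.*2.+1 (k - c) (k + 1 + c) s, (2 < size s)%N
    & (1 - eps R k c) * (total k c)%:R <= (size s)%:R].
  rewrite eq_n in ws; have [t ct st] := cube_cycle_of_seq cyc ws sz.
  by exists t; rewrite st.
have [c0|c_gt0] := posnP c.
  rewrite c0; have [s [cyc ws sz le_s]] := middle_levels_cycle k_gt0.
  exists s; split=> //; apply: (@le_trans _ _ (total k 0)%:R); last by rewrite ler_nat.
  by rewrite ler_piMl // lerBlDr lerDl -c0.
pose x : R := (c.+1)%:R ^+ 2 / (k - c)%N%:R.
(* The wide case includes c = k, where the convention sets the minimum to 1 too; so there [eps] is
   always 1/(2(c+1)). *)
have [narrow|wide] := boolP ((c < k)%N && (expR x - 1 < 1)); last first.
  have [|s [cyc ws sz le_s]] := @wide_cycle k c; first by rewrite c_gt0.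
  exists s; split=> //; have -> : eps R k c = ((2 * c.+1)%N%:R)^-1.
    rewrite /eps; case: eqP => [_|/eqP neq_c]; first by rewrite mulr1.
    move: wide; rewrite ltn_neqAle neq_c le_c /= -leNgt => /min_idPl.
    by rewrite /x => ->; rewrite mulr1.
  have : ((2 * c.+1 * total k c)%N%:R : R) <= (2 * c.+1 * size s + total k c)%N%:R.
    by rewrite ler_nat.
  rewrite natrD [in X in X <= _]natrM [X in _ <= X + _]natrM.
  have : 0 < (2 * c.+1)%N%:R :> R by rewrite ltr0n.
  move: ((2 * c.+1)%N%:R) (total k c)%:R (size s)%:R => u T N u0 le_uT.
  by rewrite -(ler_pM2l u0) mulrA mulrBr mulr1 divff ?gt_eqF //; lra.
case/andP: narrow => lt_c lt_x.
have [|s [cyc ws sz le_s]] := @narrow_cycle k c; first by rewrite c_gt0.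
exists s; split=> //.
have -> : eps R k c = (2 * c.+1%:R)^-1 * (expR x - 1).
  by rewrite /eps (ltn_eqF lt_c) natrM; congr (_ * _); apply/min_idPr/ltW.
have x0 : 0 <= x by rewrite divr_ge0 ?exprn_ge0.
apply: (@narrow_estimate R c.+1%:R (k + 2)%N%:R (k - c)%N%:R 'C(k.*2.+1, k)%:R).
- by rewrite ler1n.
- by rewrite ltr0n subn_gt0.
- by rewrite -natrD natr1; congr _%:R; lia.
(* 1 + x <= exp(x) < 2. *)
- by have := expR_ge1Dx x; rewrite -/x; lra.
- rewrite -natrM ler_nat; apply: leq_trans (central_bin_large _); last by lia.
  by apply: leq_mul; lia.
- exact: expR_ge_quadratic.
- have : (((k + 2) * total k c)%N%:R : R) <=
      ((k + 2) * (size s + 2 * c) + c.+1 ^ 2 * 'C(k.*2.+1, k))%N%:R by rewrite ler_nat.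
  rewrite [X in X <= _]natrM [X in _ <= X]natrD [X in _ <= _ + X]natrM natrX.
  rewrite [X in _ <= X + _]natrM [(size s + _)%:R]natrD [(2 * c)%:R]natrM.
  by rewrite -[c%:R](addrK 1) natr1.
have le_t := total_lower (ltnW lt_c); cbv zeta in le_t.
move: le_t; rewrite -(ler_nat R) natrD !natrM -[c.+2%:R]natr1.
by rewrite (_ : c%:R = c.+1%:R - 1) // -natr1 addrK.
Qed.

(** No growth of [c] is assumed: where [c k] is large the factor 1/(2(c+1)) is small, and where it
    is bounded the exponent is. *)
Lemma eps_cvg0 (R : realType) (c : nat -> nat) :
  (fun k => eps R k (c k)) @ \oo --> (0 : R).
Proof.
apply/cvgrPdist_le => e e_gt0; pose e' : R := Num.min e (1 / 2).
have e'_gt0 : 0 < e' by rewrite /e' lt_min e_gt0 divr_gt0.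
have [e'_le e'_half] : e' <= e /\ e' <= 1 / 2 by split; rewrite /e' ge_min; apply/orP; [left|right].
pose M := Num.bound e'^-1.
have M_large : e'^-1 < M%:R by apply: archi_boundP; rewrite invr_ge0 ltW.
have M_gt0 : 0 < M%:R :> R by apply: lt_trans M_large; rewrite invr_gt0.
have eM : 1 <= e' * M%:R by rewrite mulrC -ler_pdivrMr // div1r ltW.
(* In the case of bounded [c k], the summand [M] exceeds [c k], so k - c k is at least M^3, and M^2
   <= e' M^3. *)
exists (M + M ^ 3)%N => // k /= le_k; rewrite sub0r normrN.
have /andP[eps_ge0 eps_le] := eps_bounds R k (c k).
rewrite ger0_norm // (le_trans _ e'_le) //.
have [le_M|lt_M] := leqP M (c k).+1.
  apply: (le_trans eps_le); rewrite -div1r ler_pdivrMr ?ltr0n //.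
  by rewrite (le_trans eM) // ler_pM2l // ler_nat (leq_trans le_M) // leq_pmull.
have lt_c : (c k < k)%N.
  by rewrite (ltn_trans (ltnSn _)) // (leq_trans lt_M) // (leq_trans _ le_k) // leq_addr.
apply: (eps_small lt_c _ e'_half); rewrite ler_pdivrMr ?ltr0n ?subn_gt0 //.
apply: (@le_trans _ _ (M%:R ^+ 2)).
  by rewrite -!natrX ler_nat leq_exp2r // ltnW.
apply: (@le_trans _ _ (e' * (M ^ 3)%N%:R)).
  by rewrite natrX exprS mulrA ler_peMl // exprn_ge0.
by rewrite ler_pM2l // ler_nat; lia.
Qed.

Theorem theorem10 (R : realType) :
  exists C : forall k : nat, nat -> seq (bitstring (2 * k + 1)),
    (forall k c : nat, (1 <= k)%N -> (c <= k)%N ->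
       is_cube_cycle (k - c) (k + 1 + c) (C k c) /\
       (1 - eps R k c) * #|levels (2 * k + 1) (k - c) (k + 1 + c)|%:R
         <= (size (C k c))%:R) /\
    (forall c : nat -> nat, (forall k : nat, (1 <= k)%N -> (c k <= k)%N) ->
       (fun k : nat => (size (C k (c k)))%:R /
          #|levels (2 * k + 1) (k - c k) (k + 1 + c k)|%:R : R)
         @ \oo --> (1 : R)).
Proof.
(* A single family of cycles must serve both claims, so it is chosen for all [k] and [c]; outside
   the range the choice is arbitrary. *)
have cycles k c : exists t : seq (bitstring (2 * k + 1)),
    (0 < k)%N && (c <= k)%N -> is_cube_cycle (k - c) (k + 1 + c) t /\
    (1 - eps R k c) * #|levels (2 * k + 1) (k - c) (k + 1 + c)|%:R <= (size t)%:R.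
  have [/andP[k_gt0 le_c]|_] := boolP (_ && _); last by exists [::].
  by rewrite card_central_levels //; have [t ct] := central_cycle R k_gt0 le_c; exists t.
pose C k c := sval (cid (cycles k c)).
have C_cycle k c : (1 <= k)%N -> (c <= k)%N ->
    is_cube_cycle (k - c) (k + 1 + c) (C k c) /\
    (1 - eps R k c) * #|levels (2 * k + 1) (k - c) (k + 1 + c)|%:R <= (size (C k c))%:R.
  by move=> k_gt0 le_c; apply: (svalP (cid (cycles k c))); rewrite k_gt0.
exists C; split=> [//|c le_c].
apply: (@squeeze_cvgr _ _ _ _ (fun k => 1 - eps R k (c k)) (fun=> 1)).
- exists 1%N => // k /= k_gt0; have [[sz /andP[_ us] sub] le_s] := C_cycle _ _ k_gt0 (le_c k k_gt0).
  set T := #|_| in le_s *; have le_T : (size (C k (c k)) <= T)%N.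
    by rewrite -(card_uniqP us); apply: subset_leq_card; apply/fintype.subsetP.
  have T_gt0 : 0 < T%:R :> R by rewrite ltr0n (leq_trans _ le_T) // (leq_trans _ sz).
  by rewrite ler_pdivlMr // le_s ler_pdivrMr // mul1r ler_nat.
- rewrite -[X in _ --> X](subr0 1); apply: cvgB; first exact: cvg_cst.
  exact: eps_cvg0.
exact: cvg_cst.
Qed.
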